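(* Let $G=\mathrm{SL}_2(\mathbb{R})\times \mathrm{SL}_2(\mathbb{R})$. There is a finite set $T\subset G$ generating a Zariski-dense semigroup in $G$, such that its joint spectrum $J(T)\subset\mathbb{R}_+^2$ is a convex body whose boundary is not piecewise $C^1$, and in particular $J(T)$ is not a polygon.
   Context: Here $\mathbb{R}_+=[0,+\infty)$. For $g=(g_1,g_2)\in G$ put $\kappa(g)=(\log\|g_1\|,\log\|g_2\|)\in\mathbb{R}_+\times\mathbb{R}_+$, where $\|\cdot\|$ is the Euclidean operator norm. For $n\geq1$, $T^n:=\{t_1\cdots t_n:t_i\in T\}$. When $T$ is compact and generates a Zariski-dense semigroup in $G$ (i.e. one not contained in any proper algebraic subgroup of $G$), the joint spectrum $J(T)$ is the limit in the Hausdorff metric of $\frac1n\kappa(T^n)$ as $n\to+\infty$ (this limit exists). A convex body is a compact convex set with non-empty interior. *)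

(* Defs.v *)
From HB Require Import structures.
From mathcomp Require Import all_boot all_order all_algebra.
From mathcomp Require Import all_classical all_reals all_analysis.
(* [mpoly] is not imported: its notations clash with those of MathComp-Analysis. *)
From mathcomp Require mpoly.

Set Implicit Arguments.
Unset Strict Implicit.
Unset Printing Implicit Defensive.

Import Order.TTheory GRing.Theory Num.Theory.
Import numFieldNormedType.Exports.

Local Open Scope classical_set_scope.
Local Open Scope ring_scope.

(* This is the product ring: [g * h], [1] and [g^-1] are componentwise, and
   [SL2xSL2] is a subgroup of its group of units. *)
Notation M2xM2 R := ('M[R]_2 * 'M[R]_2)%type.

Definition SL2xSL2 (R : realType) : set (M2xM2 R) :=
  [set g | \det g.1 = 1 /\ \det g.2 = 1].

Definition set_power (R : realType) (T : set (M2xM2 R)) (n : nat) :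
    set (M2xM2 R) :=
  [set \prod_(i < n) t i | t in [set t : 'I_n -> M2xM2 R | forall i, T (t i)]].

Definition generated_semigroup (R : realType) (T : set (M2xM2 R)) :
    set (M2xM2 R) :=
  \bigcup_(n in [set n | (0 < n)%N]) set_power T n.

(* The eight matrix entries, listed in the order used by [mxvec]. *)
Definition coordinates (R : realType) (g : M2xM2 R) :
    'I_(2 * 2 + 2 * 2) -> R :=
  fun i => row_mx (mxvec g.1) (mxvec g.2) ord0 i.

Definition algebraic_subset (R : realType) (H : set (M2xM2 R)) : Prop :=
  exists P : set (mpoly.mpoly (2 * 2 + 2 * 2) R),
    H = [set g | SL2xSL2 g /\
                 forall p, P p -> mpoly.meval (coordinates g) p = 0].

Definition algebraic_subgroup (R : realType) (H : set (M2xM2 R)) : Prop :=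
  [/\ algebraic_subset H, H 1,
      (forall g h, H g -> H h -> H (g * h)) & (forall g, H g -> H g^-1)].

Definition zariski_dense (R : realType) (S : set (M2xM2 R)) : Prop :=
  forall H, algebraic_subgroup H -> S `<=` H -> H = @SL2xSL2 R.

(* The library's norm on matrices is the sup norm of the entries, hence the
   following two definitions. *)
Definition euclidean_norm (R : realType) (x : 'cV[R]_2) : R :=
  Num.sqrt (\sum_(i < 2) x i ord0 ^+ 2).

Definition operator_norm (R : realType) (A : 'M[R]_2) : R :=
  sup [set euclidean_norm (A *m x) | x in [set x | euclidean_norm x <= 1]].

Definition kappa (R : realType) (g : M2xM2 R) : R * R :=
  (ln (operator_norm g.1), ln (operator_norm g.2)).

(* On [R * R] the distance [edist] is that of the sup norm; equivalent norms
   give the same Hausdorff limits. *)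
Definition hausdorff_dist (R : realType) (A B : set (R * R)) : \bar R :=
  Order.max (ereal_sup [set edist_inf B x | x in A])
            (ereal_sup [set edist_inf A y | y in B]).

(* Compactness and non-emptiness make the limit set [J] unique. *)
Definition is_joint_spectrum (R : realType) (T : set (M2xM2 R))
    (J : set (R * R)) : Prop :=
  [/\ compact J, J !=set0 &
      hausdorff_dist [set n%:R^-1 *: kappa g | g in set_power T n] J
        @[n --> \oo] --> 0%E].

Definition convex_body (R : realType) (K : set (R * R)) : Prop :=
  [/\ compact K, convex_set K & K° !=set0].

Definition boundary (X : topologicalType) (A : set X) : set X :=
  closure A `\` A°.

(* [dgamma] is the derivative of [gamma], one-sided at [a] and [b].
   Without the condition [dgamma t != 0] the image could have corners. *)
Definition regular_C1_on (R : realType) (gamma : R -> R * R) (a b : R) : Prop :=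
  exists dgamma : R -> R * R,
    [/\ {within `[a, b], continuous gamma},
        {within `[a, b], continuous dgamma},
        (forall t, t \in `]a, b[ -> is_derive t 1 gamma (dgamma t)) &
        (forall t, t \in `[a, b] -> dgamma t != 0)].

(* [gamma] need be neither closed nor injective; for the boundary of a planar
   convex body, requiring a simple closed curve gives the same notion: in both
   cases it says that there are finitely many corners. *)
Definition piecewise_C1 (R : realType) (B : set (R * R)) : Prop :=
  exists (gamma : R -> R * R) (n : nat) (t : nat -> R),
    [/\ (0 < n)%N,
        (forall i, (i < n)%N -> t i < t i.+1),
        (forall i, (i < n)%N -> regular_C1_on gamma (t i) (t i.+1)) &
        B = gamma @` `[t 0%N, t n]].

Definition convex_hull (R : realType) (S : set (R * R)) : set (R * R) :=
  smallest (fun C => convex_set C) S.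

Definition convex_polygon (R : realType) (K : set (R * R)) : Prop :=
  exists2 S : set (R * R), finite_set S & K = convex_hull S.

(* Main.v *)
Require Import Defs.
From mathcomp Require Import all_boot all_order all_algebra.
From mathcomp Require Import all_classical all_reals all_analysis.
From mathcomp Require mpoly.
From mathcomp Require Import zify ring lra.

(** Write U(x) and L(x) for the upper and lower unipotent matrices with
    off-diagonal entry x, and D = diag(2, 1/2). The set T consists of 1,
    (U(1), D), (U(1), 1), (L(2), 1), (1, U(1)) and (1, L(1)).

    All entries are nonnegative. A product of n such matrices has its upper
    left entry comparable, up to a factor polynomial in n, to the sum of all
    its entries ([tame_entry_sum]). The logarithm of that entry is
    superadditive, that of the sum is subadditive, and the log-norm lies
    between the two; hence kappa is additive on T^n up to O(log n)
    ([kappaM]). The set J of all limits of points of (1/n) kappa(T^n)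
    ([limit_set]) is then convex, by concatenation, and every element g of T^m
    has kappa(g)/m within O(log m)/m of a point of J, the one given by the
    logarithms of the eigenvalues of g ([limit_set_power]). This and
    compactness make J the joint spectrum ([joint_spectrum_limit_set]).

    The unipotent elements of T make the semigroup Zariski dense: a polynomial
    which vanishes at all natural numbers is zero, so that an algebraic
    subgroup containing a unipotent element contains a one-parameter group.

    The boundary of J has infinitely many corners, at the points p_k
    ([corner_point]) given by the words (U(1), D)^k (L(2), 1). In the first
    factor, U(1) is parabolic, so that V(U(1)^j L(2) x) is an affine function
    of j for every linear form V. Let V be the left eigenvector of
    U(1)^k L(2), with eigenvalue rho. An affine function of j which equals
    rho V(x) at j = k stays below rho V(x) t^(j - k) at all integers j, provided
    that its relative slope is at most t - 1 and at least 1 - 1/t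
    ([tangent_bound]). This leaves an open interval of admissible t: the
    exponential t^(j - k) has to dominate the affine function only at integers.
    So the growth of a word in the first factor is at most log t per letter
    U(1), and at most log rho - k log t per letter L(2). In the second factor
    the growth is at most log 2 per letter, with D attaining it. Weighting the
    second factor by [slope] makes the cost per letter of (U(1), D) and
    (L(2), 1) equal, and that of the other letters no larger. The result is a
    support line of J at p_k which varies with t, hence a corner
    ([spectrum_support], [spectrum_corner]).

    A differentiable curve inside J through a corner has zero velocity there,
    since two independent linear functionals are critical; so a corner on a
    piecewise C^1 boundary is a breakpoint. A corner is also an extreme
    point, and a polygon has finitely many of those. *)

Set Implicit Arguments.
Unset Strict Implicit.
Unset Printing Implicit Defensive.

Import Order.TTheory GRing.Theory Num.Theory.
Import numFieldNormedType.Exports.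

Local Open Scope classical_set_scope.
Local Open Scope ring_scope.

(** * Two-by-two matrices *)

Lemma eq_pair (S T : Type) (p q : S * T) : p.1 = q.1 -> p.2 = q.2 -> p = q.
Proof. by case: p q => [? ?] [? ?] /= -> ->. Qed.

Lemma ord2P (i : 'I_2) : i = 0 \/ i = 1.
Proof. by case: i => [[|[|//]] lti]; [left|right]; exact: val_inj. Qed.

Lemma sum2E (V : nmodType) (F : 'I_2 -> V) : \sum_(i < 2) F i = F 0 + F 1.
Proof. by rewrite big_ord_recl big_ord1; congr (F _ + F _); exact: val_inj. Qed.

Section Matrices22.
Context {R : realType}.
Implicit Types (A B : 'M[R]_2) (a b c d x y r : R).

Definition mat22 a b c d : 'M[R]_2 :=
  \matrix_(i < 2, j < 2)
    if i == 0 then (if j == 0 then a else b) else (if j == 0 then c else d).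

Lemma mat22E a b c d :
  ((mat22 a b c d 0 0 = a) * (mat22 a b c d 0 1 = b) *
  (mat22 a b c d 1 0 = c) * (mat22 a b c d 1 1 = d))%type.
Proof. by rewrite !mxE. Qed.

Lemma eq_mat22 A B : A 0 0 = B 0 0 -> A 0 1 = B 0 1 -> A 1 0 = B 1 0 ->
  A 1 1 = B 1 1 -> A = B.
Proof.
move=> e00 e01 e10 e11; apply/matrixP => i j.
by have [->|->] := ord2P i; have [->|->] := ord2P j.
Qed.

Lemma mul22E A B i j : (A * B) i j = A i 0 * B 0 j + A i 1 * B 1 j.
Proof. by rewrite -mulmxE mxE sum2E. Qed.

Lemma det22 A : \det A = A 0 0 * A 1 1 - A 0 1 * A 1 0.
Proof.
rewrite (expand_det_row _ 0) sum2E /cofactor !det_mx11 !mxE /=.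
have l01 : lift (0 : 'I_2) 0 = 1 by exact: val_inj.
have l10 : lift (1 : 'I_2) 0 = 0 by exact: val_inj.
by rewrite l01 l10 !add0n expr0 mul1r expr1 mulN1r mulrN.
Qed.

Lemma tr22 A : \tr A = A 0 0 + A 1 1.
Proof. by rewrite /mxtrace sum2E. Qed.

Definition entry_sum A := A 0 0 + A 0 1 + A 1 0 + A 1 1.

(** Cayley-Hamilton turns the traces of the powers into a linear recurrence
    of order two, solved by the powers of the eigenvalues. *)
Lemma trace_exp A r n : \det A = 1 -> \tr A = r + r^-1 -> r != 0 ->
  \tr (A ^+ n) = r ^+ n + r ^- n.
Proof.
move=> detA trA r0.
have cayley m : \tr (A ^+ m.+2) = \tr A * \tr (A ^+ m.+1) - \tr (A ^+ m).
  rewrite (exprS A m.+1) (exprS A m); move: detA; rewrite !tr22 det22 !mul22E.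
  move: (A ^+ m) => B dA.
  transitivity ((A 0 0 + A 1 1) * (A 0 0 * B 0 0 + A 0 1 * B 1 0 + (A 1 0 * B 0
    1 + A 1 1 * B 1 1)) -
     (A 0 0 * A 1 1 - A 0 1 * A 1 0) * (B 0 0 + B 1 1)); first by ring.
  by rewrite dA mul1r.
suff [] : \tr (A ^+ n) = r ^+ n + r ^- n /\
    \tr (A ^+ n.+1) = r ^+ n.+1 + r ^- n.+1 by [].
elim: n => [|n [IH1 IH2]]; first by rewrite expr0 !expr1 invr1 tr22 !mxE.
split=> //; rewrite cayley IH1 IH2 trA -!exprVn !exprS.
have rr : r * r^-1 = 1 by rewrite divff.
transitivity (r * (r * r ^+ n) + r^-1 * (r^-1 * r^-1 ^+ n) +
  (r * r^-1 - 1) * (r^-1 ^+ n + r ^+ n)); first by ring.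
by rewrite rr subrr mul0r addr0.
Qed.

End Matrices22.

(** * The operator norm of a nonnegative matrix *)

Section OperatorNorm.
Context {R : realType}.
Implicit Types (A : 'M[R]_2) (x : 'cV[R]_2).

Lemma euclidean_norm2 x :
  euclidean_norm x = Num.sqrt (x 0 0 ^+ 2 + x 1 0 ^+ 2).
Proof. by rewrite /euclidean_norm sum2E. Qed.

Lemma ler_euclidean_norm x i : `|x i 0| <= euclidean_norm x.
Proof.
rewrite euclidean_norm2 -sqrtr_sqr ler_wsqrtr //.
by have [->|->] := ord2P i; rewrite ?lerDl ?lerDr sqr_ge0.
Qed.

Lemma euclidean_norm_le_sum x : euclidean_norm x <= `|x 0 0| + `|x 1 0|.
Proof.
rewrite euclidean_norm2 -[leRHS]ger0_norm ?addr_ge0// -sqrtr_sqr ler_wsqrtr//.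
by rewrite sqrrD !real_normK ?num_real// addrAC lerDl mulrn_wge0 ?mulr_ge0.
Qed.

Lemma operator_norm_bounds A :
  0 <= A 0 0 -> 0 <= A 0 1 -> 0 <= A 1 0 -> 0 <= A 1 1 ->
  A 0 0 <= operator_norm A <= entry_sum A.
Proof.
move=> a0 b0 c0 d0.
have ubA : ubound [set euclidean_norm (A *m x) | x in
    [set x | euclidean_norm x <= 1]] (entry_sum A).
  move=> _ [x /= x1 <-]; apply: (le_trans (euclidean_norm_le_sum _)).
  have x01 : `|x 0 0| <= 1 := le_trans (ler_euclidean_norm _ _) x1.
  have x11 : `|x 1 0| <= 1 := le_trans (ler_euclidean_norm _ _) x1.
  rewrite !mxE !sum2E /entry_sum -[leRHS]addrA.
  have row_le a b : 0 <= a -> 0 <= b -> `|a * x 0 0 + b * x 1 0| <= a + b.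
    move=> ag bg; apply: le_trans (ler_normD _ _) _.
    by rewrite !normrM !(ger0_norm ag, ger0_norm bg) lerD// ler_piMr.
  by rewrite lerD// row_le.
apply/andP; split; last by apply: ge_sup => //;
  exists (euclidean_norm (A *m 0)), 0 => //=;
  rewrite euclidean_norm2 !mxE expr0n addr0 sqrtr0.
(* The first basis vector witnesses the lower bound. *)
pose e : 'cV[R]_2 := \col_i (i == 0)%:R.
have e1 : euclidean_norm e <= 1.
  by rewrite euclidean_norm2 !mxE /= expr1n expr0n addr0 sqrtr1.
apply: (@le_trans _ _ (euclidean_norm (A *m e))).
  apply: le_trans (ler_euclidean_norm _ 0).
  by rewrite mxE sum2E !mxE /= mulr1 mulr0 addr0 ler_norm.
by apply: ub_le_sup; [exists (entry_sum A)|exists e].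
Qed.

End OperatorNorm.

(** * Powers of a set of matrices *)

Section Powers.
Context {R : realType}.
Variable T : set (M2xM2 R).
Implicit Types (g h a : M2xM2 R) (n m : nat).

Lemma set_power0 g : set_power T 0 g -> g = 1.
Proof. by move=> [t _ <-]; rewrite big_ord0. Qed.

Lemma set_power0_1 : set_power T 0 1.
Proof. by exists (fun=> 1); rewrite ?big_ord0// => -[]. Qed.

Lemma set_powerS_inv n g : set_power T n.+1 g ->
  exists a h, [/\ T a, set_power T n h & g = a * h].
Proof.
move=> [t tT <-]; exists (t ord0), (\prod_(i < n) t (lift ord0 i)).
by split=> //; [exists (fun i => t (lift ord0 i))|rewrite big_ord_recl].
Qed.

Lemma set_powerS n a h : T a -> set_power T n h -> set_power T n.+1 (a * h).
Proof.
move=> Ta [t tT <-].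
exists (fun i => if unlift ord0 i is Some j then t j else a).
  by move=> i /=; case: unliftP => [j|] _ //; exact: tT.
rewrite big_ord_recl unlift_none; congr (_ * _).
by apply: eq_bigr => i _; rewrite liftK.
Qed.

Lemma set_power1 a : T a -> set_power T 1 a.
Proof. by move=> Ta; rewrite -[a]mulr1; exact/set_powerS/set_power0_1. Qed.

Lemma set_power_ind (P : nat -> M2xM2 R -> Prop) : P 0%N 1 ->
  (forall n a h, T a -> P n h -> P n.+1 (a * h)) ->
  forall n g, set_power T n g -> P n g.
Proof.
move=> P0 PS; elim=> [g /set_power0 -> //|n IH g].
by move=> /set_powerS_inv [a [h [Ta /IH Ph ->]]]; exact: PS.
Qed.

Lemma set_powerD n m g h :
  set_power T n g -> set_power T m h -> set_power T (n + m) (g * h).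
Proof.
move=> gn hm; move: n g gn; apply: set_power_ind; first by rewrite mul1r.
by move=> n a g Ta ?; rewrite addSn -mulrA; exact: set_powerS.
Qed.

Lemma set_powerX n g p : set_power T n g -> set_power T (n * p) (g ^+ p).
Proof.
move=> gn; elim: p => [|p IH]; first by rewrite muln0 expr0;
  exact: set_power0_1.
by rewrite mulnS exprS; exact: set_powerD.
Qed.

Lemma set_power_indr (P : nat -> M2xM2 R -> Prop) : P 0%N 1 ->
  (forall n h a, T a -> P n h -> P n.+1 (h * a)) ->
  forall n g, set_power T n g -> P n g.
Proof.
move=> P0 PS.
suff gen n g : set_power T n g -> forall m h, P m h -> P (n + m)%N (h * g).
  by move=> n g /gen /(_ _ _ P0); rewrite addn0 mul1r.
move: n g; apply: set_power_ind => [m h|n a g Ta IH m h Ph].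
  by rewrite mulr1.
by rewrite addSnnS mulrA; apply: IH; exact: PS.
Qed.

Lemma set_power_mono n m g : T 1 -> (n <= m)%N -> set_power T n g -> set_power
  T m g.
Proof.
move=> T1 /subnK <- gn; elim: (m - n)%N => [//|d IH].
by rewrite addSn -[g]mul1r; exact: set_powerS.
Qed.

End Powers.

(** * Products of nonnegative matrices with a dominant corner entry *)
Section TameMatrices.
Context {R : realType}.
Implicit Types (A B X : 'M[R]_2) (n m : nat).

Definition nonneg_sl A :=
  [/\ 1 <= A 0 0, 0 <= A 0 1, 0 <= A 1 0, 0 <= A 1 1 & \det A = 1].

(** The generators satisfy these bounds on their entries. The bounds on the
    entries other than the first one say that a multiplication by X increases
    the ratio of the two entries of a nonnegative vector by at most 2. *)
Definition tame_letter X :=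
  [/\ nonneg_sl X, X 0 0 <= 2, X 0 1 <= 2 * X 0 0, X 1 0 <= 2 * X 0 0 &
      X 1 1 <= X 0 0].

(** What remains true of a product of n letters: the ratios grow at most
    linearly in the length. *)
Definition tame n A :=
  [/\ nonneg_sl A, A 0 1 <= (2 * n)%:R * A 0 0 & A 1 0 <= (2 * n)%:R * A 0 0].

Lemma nonneg_sl1 : nonneg_sl 1.
Proof. by split; rewrite ?det1// !mxE. Qed.

Lemma nonneg_slM A B : nonneg_sl A -> nonneg_sl B -> nonneg_sl (A * B).
Proof.
move=> [a b c d dA] [a' b' c' d' dB].
have a0 : 0 <= A 0 0 by apply: le_trans a.
have a0' : 0 <= B 0 0 by apply: le_trans a'.
split; rewrite ?mul22E; try by rewrite addr_ge0// mulr_ge0.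
  by rewrite -[leLHS]addr0 lerD// ?mulr_ge0// mulr_ege1.
by rewrite det_mulmx dA dB mulr1.
Qed.

(** The first column is controlled by multiplying on the left, the first row
    by multiplying on the right ([tame_col]). *)
Lemma tame_row n X A : tame_letter X -> nonneg_sl A ->
  A 1 0 <= (2 * n)%:R * A 0 0 -> (X * A) 1 0 <= (2 * n.+1)%:R * (X * A) 0 0.
Proof.
move=> [[x00 x01 x10 x11 _] _ _ lx10 lx11] [a00 a01 a10 a11 _] la.
have a0 : 0 <= A 0 0 by apply: le_trans a00.
have x0 : 0 <= X 0 0 by apply: le_trans x00.
rewrite !mul22E mulrDr mulnS natrD mulrDl.
have h1 : X 1 0 * A 0 0 <= 2 * X 0 0 * A 0 0 by rewrite ler_wpM2r.
have h2 : X 1 1 * A 1 0 <= X 0 0 * ((2 * n)%:R * A 0 0) by rewrite ler_pM.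
have h3 : 0 <= (2 + (2 * n)%:R) * (X 0 1 * A 1 0).
  by rewrite mulr_ge0 ?mulr_ge0// addr_ge0.
lra.
Qed.

Lemma tame_col n X A : tame_letter X -> nonneg_sl A ->
  A 0 1 <= (2 * n)%:R * A 0 0 -> (A * X) 0 1 <= (2 * n.+1)%:R * (A * X) 0 0.
Proof.
move=> [[x00 x01 x10 x11 _] _ lx01 _ lx11] [a00 a01 a10 a11 _] la.
have a0 : 0 <= A 0 0 by apply: le_trans a00.
have x0 : 0 <= X 0 0 by apply: le_trans x00.
rewrite !mul22E mulrDr mulnS natrD mulrDl.
have h1 : A 0 0 * X 0 1 <= A 0 0 * (2 * X 0 0) by rewrite ler_wpM2l.
have h2 : A 0 1 * X 1 1 <= ((2 * n)%:R * A 0 0) * X 0 0 by rewrite ler_pM.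
have h3 : 0 <= (2 + (2 * n)%:R) * (A 0 1 * X 1 0).
  by rewrite mulr_ge0 ?mulr_ge0// addr_ge0.
lra.
Qed.

Lemma nonneg_sl_entry_sum A : nonneg_sl A -> A 0 0 <= entry_sum A.
Proof. by move=> [a b c d _]; rewrite /entry_sum -!addrA lerDl !addr_ge0. Qed.

(** The last entry is recovered from the other three through the determinant. *)
Lemma tame_entry_sum n A : tame n A ->
  entry_sum A <= (2 * n + 2)%:R ^+ 2 * A 0 0.
Proof.
move=> [[a b c d]]; rewrite det22 /entry_sum natrD => dA lb lc.
set N := (2 * n)%:R in lb lc *; have N0 : 0 <= N by rewrite ler0n.
have a0 : 0 < A 0 0 by apply: lt_le_trans a.
have bc : A 0 1 * A 1 0 <= (N * A 0 0) * (N * A 0 0) by rewrite ler_pM.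
have aa : 1 <= A 0 0 * A 0 0 by rewrite mulr_ege1.
have ld : A 1 1 <= (1 + N ^+ 2) * A 0 0.
  rewrite -(ler_pM2l a0); move/eqP: dA; rewrite subr_eq => /eqP ->.
  by rewrite expr2; lra.
have Na : 0 <= N * A 0 0 by rewrite mulr_ge0// ltW.
rewrite expr2 in ld *; lra.
Qed.

Lemma entry_sumM A B : nonneg_sl A -> nonneg_sl B ->
  entry_sum (A * B) <= entry_sum A * entry_sum B.
Proof.
move=> [a b c d _] [a' b' c' d' _]; rewrite /entry_sum !mul22E.
have a0 : 0 <= A 0 0 by apply: le_trans a.
have a0' : 0 <= B 0 0 by apply: le_trans a'.
rewrite -subr_ge0.
set z := (X in 0 <= X).
suff -> : z = A 0 0 * (B 1 0 + B 1 1) + A 0 1 * (B 0 0 + B 0 1)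
  + A 1 0 * (B 1 0 + B 1 1) + A 1 1 * (B 0 0 + B 0 1).
  by rewrite !(addr_ge0, mulr_ge0).
by rewrite /z; ring.
Qed.

End TameMatrices.

(** * Almost additivity of the log-norm *)
Section LogNorm.
Context {R : realType}.
Implicit Types (A B : 'M[R]_2) (n m : nat).

Definition log_norm A : R := ln (operator_norm A).

(** The logarithm of the factor in [tame_entry_sum]: how far the log-norm of a
    word of length n can be from being additive. *)
Definition defect n : R := ln ((2 * n + 2)%:R ^+ 2).

Lemma defect_le n m : (n <= m)%N -> defect n <= defect m.
Proof.
move=> nm; rewrite ler_ln ?posrE ?exprn_gt0 ?ltr0n ?addn2//.
by rewrite lerXn2r ?nnegrE ?ler0n// ler_nat; lia.
Qed.

Lemma log_norm_bounds A : nonneg_sl A ->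
  ln (A 0 0) <= log_norm A <= ln (entry_sum A).
Proof.
move=> sA; have [a b c d _] := sA.
have a0 : 0 < A 0 0 by apply: lt_le_trans a.
have /andP[lo hi] := operator_norm_bounds (ltW a0) b c d.
have N0 := lt_le_trans a0 lo.
by rewrite /log_norm !ler_ln ?posrE ?lo ?hi// (lt_le_trans N0).
Qed.

Lemma log_norm_ge0 A : nonneg_sl A -> 0 <= log_norm A.
Proof.
move=> sA; have /andP[lo _] := log_norm_bounds sA.
by apply: le_trans lo; apply: ln_ge0; case: sA.
Qed.

Lemma ln_entry_sum n A : tame n A -> ln (entry_sum A) <= ln (A 0 0) + defect n.
Proof.
move=> tA; have [[a b c d _] _ _] := tA.
have a0 : 0 < A 0 0 by apply: lt_le_trans a.
have n0 : 0 < (2 * n + 2)%:R ^+ 2 :> R by rewrite exprn_gt0// ltr0n addn2.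
rewrite addrC /defect -lnM ?posrE// ler_ln ?posrE ?mulr_gt0//.
  exact: tame_entry_sum.
by apply: (lt_le_trans a0); apply: nonneg_sl_entry_sum; case: tA.
Qed.

(** The upper left entry is supermultiplicative, the sum of the entries is
    submultiplicative, and the norm is between them. *)
Lemma log_normM n m A B : tame n A -> tame m B ->
  `|log_norm (A * B) - (log_norm A + log_norm B)| <= defect n + defect m.
Proof.
move=> tA tB; have [sA _ _] := tA; have [sB _ _] := tB.
have sAB := nonneg_slM sA sB.
have /andP[loA hiA] := log_norm_bounds sA.
have /andP[loB hiB] := log_norm_bounds sB.
have /andP[loAB hiAB] := log_norm_bounds sAB.
have eA := ln_entry_sum tA; have eB := ln_entry_sum tB.
have [a b c d _] := sA; have [a' b' c' d' _] := sB.
have a0 : 0 < A 0 0 by apply: lt_le_trans a.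
have a0' : 0 < B 0 0 by apply: lt_le_trans a'.
have sA0 := lt_le_trans a0 (nonneg_sl_entry_sum sA).
have sB0 := lt_le_trans a0' (nonneg_sl_entry_sum sB).
have sup : ln (A 0 0) + ln (B 0 0) <= ln ((A * B) 0 0).
  rewrite -lnM ?posrE// ler_ln ?posrE ?mulr_gt0 ?mul22E ?lerDl ?mulr_ge0//.
  by rewrite (@lt_le_trans _ _ (A 0 0 * B 0 0)) ?mulr_gt0// lerDl mulr_ge0.
have sub : ln (entry_sum (A * B)) <= ln (entry_sum A) + ln (entry_sum B).
  rewrite -lnM ?posrE// ler_ln ?posrE ?mulr_gt0 ?entry_sumM//.
  apply: lt_le_trans (nonneg_sl_entry_sum sAB).
  by apply: lt_le_trans ltr01 _; case: sAB.
by rewrite ler_norml; apply/andP; split; lra.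
Qed.

(** The trace of A^p is r^p + r^-p, and it lies between the upper left entry
    and the sum of the entries. *)
Lemma log_normX n p A r : nonneg_sl A -> tame n (A ^+ p) -> 1 <= r ->
  \tr A = r + r^-1 -> `|log_norm (A ^+ p) - p%:R * ln r| <= defect n + ln 2.
Proof.
move=> [_ _ _ _ dA] tAp r1 trA.
have r0 : 0 < r by apply: lt_le_trans r1.
have [sAp _ _] := tAp; have [a b c d _] := sAp.
have /andP[lo hi] := log_norm_bounds sAp.
have e := ln_entry_sum tAp.
have := trace_exp p dA trA (lt0r_neq0 r0); rewrite tr22 => trAp.
have rp : 1 <= r ^+ p by rewrite exprn_ege1.
have rp0 : 0 < r ^+ p by apply: lt_le_trans rp.
have rp' : 0 < r ^- p <= 1 by rewrite invr_gt0 rp0 invf_le1.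
have a0 : 0 < (A ^+ p) 0 0 by apply: lt_le_trans a.
have upper : ln ((A ^+ p) 0 0) <= p%:R * ln r + ln 2.
  rewrite mulr_natl -lnXn// -lnM ?posrE// ler_ln ?posrE ?mulr_gt0//; lra.
have lower : p%:R * ln r <= ln (entry_sum (A ^+ p)).
  rewrite mulr_natl -lnXn// ler_ln ?posrE//; first by rewrite /entry_sum; lra.
  exact: lt_le_trans a0 (nonneg_sl_entry_sum sAp).
have l2 : 0 <= ln 2 :> R by rewrite ln_ge0// ler1n.
by rewrite ler_norml; apply/andP; split; lra.
Qed.

Lemma nonneg_sl_eigenvalue A : nonneg_sl A -> exists2 r, 1 <= r & \tr A = r +
  r^-1.
Proof.
move=> [a b c d]; rewrite det22 tr22; set t := A 0 0 + A 1 1 => dA.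
have bc : 0 <= A 0 1 * A 1 0 by rewrite mulr_ge0.
have t2 : 4 <= t ^+ 2.
  have : 0 <= (A 0 0 - A 1 1) ^+ 2 by exact: sqr_ge0.
  by rewrite /t !expr2; lra.
have t0 : 2 <= t.
  rewrite leNgt; apply/negP => t2'; have : 0 <= t by rewrite /t; lra.
  by move: t2; rewrite expr2 => ? ?; nra.
have s0 : 0 <= Num.sqrt (t ^+ 2 - 4) by exact: sqrtr_ge0.
have sE : Num.sqrt (t ^+ 2 - 4) ^+ 2 = t ^+ 2 - 4 by rewrite sqr_sqrtr//; lra.
set s := Num.sqrt _ in s0 sE.
exists ((t + s) / 2); first by lra.
have h : (t + s) / 2 * ((t - s) / 2) = 1 by field: sE.
have rn0 : (t + s) / 2 != 0 by apply: lt0r_neq0; lra.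
suff -> : ((t + s) / 2)^-1 = (t - s) / 2 by field.
by apply: (mulfI rn0); rewrite h mulfV.
Qed.

Lemma defect_small (e : R) : 0 < e -> \forall n \near \oo, defect n <= e * n%:R.
Proof.
move=> e0; near=> n.
have n0 : (0 < n)%N by near: n; exact: nbhs_infty_gt.
have s0 : 0 < Num.sqrt (2 * n + 2)%:R :> R by rewrite sqrtr_gt0 ltr0n addn2.
have -> : defect n = 4 * ln (Num.sqrt (2 * n + 2)%:R).
  rewrite /defect -[in LHS](@sqr_sqrtr _ (2 * n + 2)%:R) ?ler0n//.
  by rewrite -exprM lnXn// mulr_natl.
apply: (@le_trans _ _ (4 * (2 * Num.sqrt n%:R))).
  rewrite ler_pM2l//; apply: le_trans (ltW (ln_sublinear s0)) _.
  have -> : 2 = Num.sqrt (2 ^+ 2) :> R by rewrite sqrtr_sqr ger0_norm.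
  by rewrite -sqrtrM ?exprn_ge0// ler_wsqrtr// -natrX -natrM ler_nat; lia.
have sn : 8 / e <= Num.sqrt n%:R.
  rewrite -[leLHS]ger0_norm ?divr_ge0 ?(ltW e0)// -sqrtr_sqr ler_wsqrtr//.
  near: n; exact: nbhs_infty_ger.
rewrite -[n%:R in leRHS]sqr_sqrtr ?ler0n// expr2 !mulrA ler_wpM2r ?sqrtr_ge0//.
move: sn; rewrite ler_pdivrMr//; lra.
Unshelve. all: by end_near. Qed.

Lemma const_small (c e : R) : 0 < e -> \forall n \near \oo, c <= e * n%:R.
Proof.
move=> e0; near=> n; rewrite mulrC -ler_pdivrMr//.
by near: n; exact: nbhs_infty_ger.
Unshelve. all: by end_near. Qed.

End LogNorm.

(** * Limits of normalized log-norms *)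

Lemma norm_pair_le (R : realType) (x : R * R) (e : R) :
  (`|x| <= e) = (`|x.1| <= e) && (`|x.2| <= e).
Proof. by rewrite prod_normE ge_max. Qed.

Section LimitSet.
Context {R : realType}.
Variable T : set (M2xM2 R).
Hypothesis tameT : forall g, T g -> tame_letter g.1 /\ tame_letter g.2.
Hypothesis T1 : T 1.

(** The lower limit of the sets (1/n) kappa(T^n). The inequality is multiplied
    by n, which avoids dividing by zero. *)
Definition limit_set : set (R * R) :=
  [set x | forall e, 0 < e -> \forall n \near \oo,
     exists2 g, set_power T n g & `|kappa g - n%:R *: x| <= e * n%:R].

(** Row and column ratios need inductions on opposite sides of the product. *)
Lemma set_power_tame n g : set_power T n g -> tame n g.1 /\ tame n g.2.
Proof.
move=> gn.
have sl : nonneg_sl g.1 /\ nonneg_sl g.2.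
  move: n g gn; apply: set_power_ind => [|_ a h Ta [h1 h2]].
    by split; exact: nonneg_sl1.
  by have [[? _ _ _ _] [? _ _ _ _]] := tameT Ta; split; exact: nonneg_slM.
have row : [/\ nonneg_sl g.1, nonneg_sl g.2,
    g.1 1 0 <= (2 * n)%:R * g.1 0 0 & g.2 1 0 <= (2 * n)%:R * g.2 0 0].
  move: n g gn {sl}; apply: set_power_ind => [|n a h Ta [h1 h2 r1 r2]].
    by split; rewrite ?muln0 ?mul0r ?mxE//; exact: nonneg_sl1.
  have [l1 l2] := tameT Ta.
  by split; try exact: tame_row; apply: nonneg_slM => //; [case: l1|case: l2].
have col : [/\ nonneg_sl g.1, nonneg_sl g.2,
    g.1 0 1 <= (2 * n)%:R * g.1 0 0 & g.2 0 1 <= (2 * n)%:R * g.2 0 0].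
  move: n g gn {sl row}; apply: set_power_indr => [|n h a Ta [h1 h2 r1 r2]].
    by split; rewrite ?muln0 ?mul0r ?mxE//; exact: nonneg_sl1.
  have [l1 l2] := tameT Ta.
  by split; try exact: tame_col; apply: nonneg_slM => //; [case: l1|case: l2].
by case: sl => s1 s2; case: row => _ _ r1 r2; case: col => _ _ c1 c2; split;
  split.
Qed.

Lemma kappaM n m g h : set_power T n g -> set_power T m h ->
  `|kappa (g * h) - (kappa g + kappa h)| <= defect n + defect m.
Proof.
move=> /set_power_tame [g1 g2] /set_power_tame [h1 h2].
by rewrite norm_pair_le !log_normM.
Qed.

Lemma pairX (g : M2xM2 R) p : g ^+ p = (g.1 ^+ p, g.2 ^+ p).
Proof. by elim: p => [//|p IH]; rewrite !exprS IH. Qed.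

Lemma kappaX m p g r1 r2 : set_power T m g -> 1 <= r1 -> 1 <= r2 ->
  \tr g.1 = r1 + r1^-1 -> \tr g.2 = r2 + r2^-1 ->
  `|kappa (g ^+ p) - p%:R *: (ln r1, ln r2)| <= defect (m * p) + ln 2.
Proof.
move=> gm r11 r21 tr1 tr2.
have [g1 g2] := set_power_tame gm.
have [t1 t2] := set_power_tame (set_powerX p gm).
rewrite norm_pair_le; rewrite pairX /= in t1 t2 *.
by rewrite !log_normX//; [case: g2|case: g1].
Qed.

(** A point for each length n comes from the power of g with exponent the
    integer part of n / m; as 1 is in T, its length can be increased to n. *)
Lemma limit_set_power m g r1 r2 : (0 < m)%N -> set_power T m g ->
  1 <= r1 -> 1 <= r2 -> \tr g.1 = r1 + r1^-1 -> \tr g.2 = r2 + r2^-1 ->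
  limit_set (m%:R^-1 *: (ln r1, ln r2)).
Proof.
move=> m0 gm r11 r21 tr1 tr2 e e0.
pose x : R * R := (ln r1, ln r2).
have [e20 mR0] : 0 < e / 2 /\ 0 < m%:R :> R by rewrite divr_gt0// ltr0n.
near=> n.
exists (g ^+ (n %/ m)).
  apply: set_power_mono T1 _ (set_powerX (n %/ m) gm).
  by rewrite mulnC leq_divM.
rewrite -/x.
have -> : kappa (g ^+ (n %/ m)) - n%:R *: (m%:R^-1 *: x) =
   (kappa (g ^+ (n %/ m)) - (n %/ m)%:R *: x) +
   ((n %/ m)%:R - n%:R / m%:R) *: x.
  by rewrite scalerA scalerBl addrA subrK.
have k1 := kappaX (n %/ m) gm r11 r21 tr1 tr2.
have dn : defect (m * (n %/ m)) <= defect n :> R by rewrite defect_le// mulnC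
  leq_divM.
have small1 : defect n <= e / 2 * n%:R by near: n; exact: defect_small.
have small2 : ln 2 + `|x| <= e / 2 * n%:R by near: n; exact: const_small.
have q1 : `|(n %/ m)%:R - n%:R / m%:R| <= 1 :> R.
  have lo : (n %/ m)%:R <= n%:R / m%:R :> R.
    by rewrite ler_pdivlMr// -natrM ler_nat leq_divM.
  have hi : n%:R / m%:R <= (n %/ m)%:R + 1 :> R.
    by rewrite ler_pdivrMr// natr1 -natrM ler_nat ltnW// ltn_ceil.
  by rewrite ler_norml; apply/andP; split; lra.
apply: le_trans (ler_normD _ _) _; rewrite normrZ.
have : `|(n %/ m)%:R - n%:R / m%:R| * `|x| <= `|x| by rewrite ler_piMl.
rewrite -/x in k1; lra.
Unshelve. all: by end_near. Qed.

Lemma limit_set_near m g : (0 < m)%N -> set_power T m g ->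
  exists2 x, limit_set x & `|kappa g - m%:R *: x| <= defect m + ln 2.
Proof.
move=> m0 gm; have [[s1 _ _] [s2 _ _]] := set_power_tame gm.
have [r1 r11 tr1] := nonneg_sl_eigenvalue s1.
have [r2 r21 tr2] := nonneg_sl_eigenvalue s2.
exists (m%:R^-1 *: (ln r1, ln r2)); first exact: limit_set_power gm _ _ _ _.
have := kappaX 1 gm r11 r21 tr1 tr2; rewrite expr1 muln1 scale1r.
by rewrite scalerA divff ?scale1r// pnatr_eq0 -lt0n.
Qed.

(** How linear inequalities on the log-norms of words are transferred to the
    limit set: the additive constant c disappears. *)
Lemma limit_set_linear a b c C :
  (forall n g, set_power T n g ->
     a * (kappa g).1 + b * (kappa g).2 <= c + n%:R * C) ->
  forall x, limit_set x -> a * x.1 + b * x.2 <= C.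
Proof.
move=> bound x Jx; apply/ler_addgt0Pr => e e0.
pose d := e / (2 * (`|a| + `|b| + 1)).
have w0 : 0 < `|a| + `|b| + 1 by rewrite ltr_wpDl// addr_ge0.
have d0 : 0 < d by rewrite divr_gt0 ?mulr_gt0.
near \oo => n.
have n0 : 0 < n%:R :> R by rewrite ltr0n; near: n; exact: nbhs_infty_gt.
have [g gn] : exists2 g, set_power T n g & `|kappa g - n%:R *: x| <= d * n%:R.
  by near: n; exact: Jx.
have cn : c <= e / 2 * n%:R by near: n; apply: const_small; rewrite divr_gt0.
rewrite norm_pair_le => /andP[k1 k2].
have := bound n g gn.
set k := kappa g in k1 k2 *; rewrite /= in k1 k2.
have h1 : - (a * (k.1 - n%:R * x.1)) <= `|a| * (d * n%:R).
  by apply: le_trans (ler_norm _) _; rewrite normrN normrM ler_wpM2l.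
have h2 : - (b * (k.2 - n%:R * x.2)) <= `|b| * (d * n%:R).
  by apply: le_trans (ler_norm _) _; rewrite normrN normrM ler_wpM2l.
have dn0 : 0 < d * n%:R by rewrite mulr_gt0.
have de : (`|a| + `|b| + 1) * (d * n%:R) = e / 2 * n%:R.
  by rewrite /d; field; rewrite lt0r_neq0.
by move=> h; rewrite -(ler_pM2l n0); lra.
Unshelve. all: by end_near. Qed.

Lemma limit_set_ge0 x : limit_set x -> 0 <= x.1 /\ 0 <= x.2.
Proof.
move=> Jx; have pos n g : set_power T n g -> 0 <= (kappa g).1 /\ 0 <= (kappa
  g).2.
  by move=> /set_power_tame[[s1 _ _] [s2 _ _]]; split; exact: log_norm_ge0.
have h1 : -1 * x.1 + 0 * x.2 <= 0.
  by apply: (@limit_set_linear _ _ 0) => // n g /pos[? ?]; lra.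
have h2 : 0 * x.1 + -1 * x.2 <= 0.
  by apply: (@limit_set_linear _ _ 0) => // n g /pos[? ?]; lra.
by split; lra.
Qed.

Lemma kappa_le n g : set_power T n g ->
  (kappa g).1 <= ln 2 + n%:R * ln 12 /\ (kappa g).2 <= ln 2 + n%:R * ln 12.
Proof.
suff H : set_power T n g -> [/\ nonneg_sl g.1, nonneg_sl g.2,
    entry_sum g.1 <= 2 * 12 ^+ n & entry_sum g.2 <= 2 * 12 ^+ n].
  move=> /H [s1 s2 e1 e2].
  have fin A : nonneg_sl A -> entry_sum A <= 2 * 12 ^+ n ->
      log_norm A <= ln 2 + n%:R * ln 12.
    move=> sA eA; have /andP[_ hi] := log_norm_bounds sA; apply: le_trans hi _.
    rewrite mulr_natl -lnXn// -lnM ?posrE ?exprn_gt0//.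
    rewrite ler_ln ?posrE ?mulr_gt0 ?exprn_gt0//.
    apply: lt_le_trans (nonneg_sl_entry_sum sA).
    by apply: lt_le_trans ltr01 _; case: sA.
  by split; exact: fin.
move: n g; apply: set_power_ind => [|n a h Ta [s1 s2 e1 e2]].
  have e1 : entry_sum (1 : 'M[R]_2) <= 2 * 12 ^+ 0.
    by rewrite /entry_sum !mxE /= expr0; lra.
  by split=> //; exact: nonneg_sl1.
have step X A : tame_letter X -> nonneg_sl A -> entry_sum A <= 2 * 12 ^+ n ->
    entry_sum (X * A) <= 2 * 12 ^+ n.+1.
  move=> [sX x0 x1 x2 x3] sA eA; apply: le_trans (entry_sumM sX sA) _.
  rewrite exprS mulrCA; apply: ler_pM => //.
  - by apply: le_trans (nonneg_sl_entry_sum sX); apply: le_trans ler01 _;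
    case: sX.
  - by apply: le_trans (nonneg_sl_entry_sum sA); apply: le_trans ler01 _;
    case: sA.
  - by rewrite /entry_sum; lra.
have [l1 l2] := tameT Ta; split; try exact: step.
  by apply: nonneg_slM => //; case: l1.
by apply: nonneg_slM => //; case: l2.
Qed.

Lemma limit_set_le x : limit_set x -> x.1 <= ln 12 /\ x.2 <= ln 12.
Proof.
move=> Jx.
have h1 : 1 * x.1 + 0 * x.2 <= ln 12.
  by apply: (@limit_set_linear _ _ (ln 2)) => // n g /kappa_le[? ?]; lra.
have h2 : 0 * x.1 + 1 * x.2 <= ln 12.
  by apply: (@limit_set_linear _ _ (ln 2)) => // n g /kappa_le[? ?]; lra.
by split; lra.
Qed.

Lemma limit_set_closed : closed limit_set.
Proof.
move=> x clx e e0; have e20 : 0 < e / 2 by rewrite divr_gt0.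
have [y [Jy]] := clx _ (nbhsx_ballx x _ e20).
rewrite -ball_normE /= => xy; near=> n.
have [g gn gy] : exists2 g, set_power T n g &
    `|kappa g - n%:R *: y| <= e / 2 * n%:R by near: n; exact: Jy.
exists g => //.
have -> : kappa g - n%:R *: x = (kappa g - n%:R *: y) - n%:R *: (x - y).
  by rewrite scalerBr opprB addrA subrK.
apply: le_trans (ler_normB _ _) _; rewrite normrZ normr_nat.
have : n%:R * `|x - y| <= n%:R * (e / 2) by rewrite ler_wpM2l// ltW.
lra.
Unshelve. all: by end_near. Qed.

Lemma limit_set_compact : compact limit_set.
Proof.
apply: subclosed_compact limit_set_closed
  (compact_setX (@segment_compact R 0 (ln 12)) (@segment_compact R 0 (ln 12)))
    _.
move=> x Jx; have [x1 x2] := limit_set_ge0 Jx; have [x3 x4] := limit_set_le Jx.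
by split; rewrite /= in_itv /=; apply/andP.
Qed.

(** Concatenate a word for x of length about t n with a word for y of length
    about (1 - t) n. *)
Lemma limit_set_convex_comb x y t : limit_set x -> limit_set y ->
  0 < t -> t < 1 -> limit_set (t *: x + (1 - t) *: y).
Proof.
move=> Jx Jy t0 t1 e e0.
have e40 : 0 < e / 4 by rewrite divr_gt0.
have t10 : 0 < 1 - t by rewrite subr_gt0.
have [N1 _ N1P] := Jx _ e40; have [N2 _ N2P] := Jy _ e40.
near=> n.
pose n1 := Num.truncn (t * n%:R); pose n2 := (n - n1)%N.
have /andP[lo hi] : n1%:R <= t * n%:R < n1.+1%:R.
  by rewrite truncn_itv// mulr_ge0// ltW.
have n1n : (n1 <= n)%N.
  by rewrite -(ler_nat R) (le_trans lo)// ler_piMl// ltW.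
have n2E : n2%:R = n%:R - n1%:R :> R by rewrite natrB.
have n1N : (N1 <= n1)%N.
  rewrite -ltnS -(ltr_nat R); apply: le_lt_trans hi.
  by near: n; exact: const_small.
have n2N : (N2 <= n2)%N.
  rewrite -(ler_nat R) n2E; apply: (@le_trans _ _ ((1 - t) * n%:R)); last lra.
  by near: n; exact: const_small.
have [g gn gx] := N1P _ n1N; have [h hn hy] := N2P _ n2N.
exists (g * h); first by rewrite -(subnKC n1n); exact: set_powerD.
have k := kappaM gn hn.
have d1 : defect n1 <= defect n :> R by rewrite defect_le.
have d2 : defect n2 <= defect n :> R by rewrite defect_le// leq_subr.
have small1 : defect n <= e / 8 * n%:R by near: n; apply: defect_small;
  rewrite divr_gt0.
have small2 : `|x - y| <= e / 4 * n%:R by near: n; apply: const_small.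
have en0 : 0 <= e * n%:R by rewrite mulr_ge0 ?ler0n ?(ltW e0).
have -> : kappa (g * h) - n%:R *: (t *: x + (1 - t) *: y) =
    (kappa (g * h) - (kappa g + kappa h)) + (kappa g - n1%:R *: x) +
    (kappa h - n2%:R *: y) + (n1%:R - t * n%:R) *: (x - y).
  rewrite n2E; apply/eqP; rewrite xpair_eqE /=.
  by apply/andP; split; apply/eqP; rewrite /GRing.scale /=; ring.
do 3![apply: le_trans (ler_normD _ _) _; rewrite -?lerBrDr]; rewrite ?normrZ.
have : `|n1%:R - t * n%:R| * `|x - y| <= 1 * `|x - y|.
  rewrite ler_wpM2r// ler_norml; apply/andP; split; rewrite -natr1 in hi; lra.
have {}hy : `|kappa h - n2%:R *: y| <= e / 4 * (n%:R - n1%:R) by rewrite -n2E.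
move: `|kappa h - _| `|kappa g - _| `|kappa _ - (_ + _)| gx hy k small2.
move: (defect n) (defect n1) (defect n2) d1 d2 small1.
clear -en0; move: (n1%:R : R) => {}n1 *; lra.
Unshelve. all: by end_near. Qed.

Lemma limit_set_convex : convex_set limit_set.
Proof.
apply/convex_setW => x y /set_mem Jx /set_mem Jy k k0 k1.
by apply/mem_set; exact: limit_set_convex_comb.
Qed.

(** The rank n from which a point of the limit set is approximated depends on
    the point; compactness makes it uniform. *)
Lemma limit_set_approx (e : R) : 0 < e -> \forall n \near \oo,
  forall x, limit_set x ->
    exists2 g, set_power T n g & `|kappa g - n%:R *: x| <= e * n%:R.
Proof.
move=> e0; have e20 : 0 < e / 2 by rewrite divr_gt0.
have := limit_set_compact; rewrite compact_near_coveringP => cover.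
have := @cover nat \oo (fun n x =>
  exists2 g, set_power T n g & `|kappa g - n%:R *: x| <= e * n%:R) _.
apply=> x Jx; near=> y n => /=.
have [g gn gx] : exists2 g, set_power T n g &
    `|kappa g - n%:R *: x| <= e / 2 * n%:R by near: n; exact: Jx.
exists g => //.
have -> : kappa g - n%:R *: y = (kappa g - n%:R *: x) + n%:R *: (x - y).
  by rewrite scalerBr addrA subrK.
have xy : `|x - y| < e / 2.
  have : ball x (e / 2) y by near: y; exact: nbhsx_ballx.
  by rewrite -ball_normE.
apply: le_trans (ler_normD _ _) _; rewrite normrZ normr_nat.
have : n%:R * `|x - y| <= n%:R * (e / 2) by rewrite ler_wpM2l// ltW.
lra.
Unshelve. all: by end_near. Qed.

End LimitSet.

(** * The limit set is the joint spectrum *)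
Lemma cvge0P (R : realType) (f : nat -> \bar R) :
  (forall e, 0 < e -> \forall n \near \oo, (0 <= f n <= e%:E)%E) ->
  f n @[n --> \oo] --> 0%E.
Proof.
move=> small; apply/fine_cvgP; split.
  apply: filterS (small 1 ltr01) => n /andP[f0 f1].
  by rewrite ge0_fin_numE// (le_lt_trans f1) ?ltry.
apply/cvgrPdist_le => e e0; apply: filterS (small e e0) => n /andP[f0 fe].
have ff : f n \is a fin_num by rewrite ge0_fin_numE// (le_lt_trans fe) ?ltry.
rewrite /= sub0r normrN ger0_norm ?fine_ge0//.
by rewrite -lee_fin fineK.
Qed.

Lemma edist_inf_le (R : realType) (A : set (R * R)) x y e : 0 < e -> A y ->
  `|x - y| <= e -> (edist_inf A x <= (e *+ 2)%:E)%E.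
Proof.
move=> e0 Ay xy; apply: (@le_trans _ _ (edist (x, y))).
  by apply: ereal_inf_lbound; exists y.
apply: edist_fin; first by rewrite mulrn_wgt0.
by rewrite -ball_normE /=; apply: le_lt_trans xy _; rewrite mulr2n ltrDl.
Qed.

Section JointSpectrum.
Context {R : realType}.
Variable T : set (M2xM2 R).
Hypothesis tameT : forall g, T g -> tame_letter g.1 /\ tame_letter g.2.
Hypothesis T1 : T 1.

Lemma limit_set0 : limit_set T 0.
Proof.
have := @limit_set_power _ _ tameT T1 1 1 1 1 isT (set_power1 T1) (lexx _)
  (lexx _).
by rewrite ln1 scaler0; apply; rewrite mxtrace1 invr1.
Qed.

Lemma joint_spectrum_limit_set : is_joint_spectrum T (limit_set T).
Proof.
split; [exact: limit_set_compact|by exists 0; exact: limit_set0|].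
apply: cvge0P => e e0; have e20 : 0 < e / 2 by rewrite divr_gt0.
have e40 : 0 < e / 2 / 2 by rewrite divr_gt0.
have eE : e = (e / 2) *+ 2 by rewrite mulr2n -splitr.
near=> n.
have n0 : (0 < n)%N by near: n; exact: nbhs_infty_gt.
have nR0 : 0 < n%:R :> R by rewrite ltr0n.
have rescale (k x : R * R) :
    `|n%:R^-1 *: k - x| <= e / 2 <-> `|k - n%:R *: x| <= e / 2 * n%:R.
  have -> : n%:R^-1 *: k - x = n%:R^-1 *: (k - n%:R *: x).
    by rewrite scalerBr scalerA mulVf ?scale1r// lt0r_neq0.
  by rewrite normrZ gtr0_norm ?invr_gt0// mulrC ler_pdivrMr.
apply/andP; split.
  rewrite le_max; apply/orP; left; apply: le_ereal_sup_tmp.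
  exists (edist_inf (limit_set T) (n%:R^-1 *: kappa (1 : M2xM2 R)));
    last exact: edist_inf_ge0.
  exists (n%:R^-1 *: kappa (1 : M2xM2 R)) => //; exists 1 => //.
  by apply: (@set_power_mono _ _ 0) => //; exact: set_power0_1.
rewrite ge_max; apply/andP; split; apply: ge_ereal_sup => _ [x + <-].
  move=> [g gn <-]; have [y Jy gy] := limit_set_near tameT T1 n0 gn.
  rewrite eE; apply: (edist_inf_le _ Jy) => //; apply/rescale.
  apply: le_trans gy _.
  have -> : e / 2 * n%:R = e / 2 / 2 * n%:R + e / 2 / 2 * n%:R :> R by lra.
  apply: lerD; near: n; [exact: defect_small|exact: const_small].
move=> Jx.
have [g gn gx] : exists2 g, set_power T n g & `|kappa g - n%:R *: x| <= e / 2 *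
  n%:R.
  by move: x Jx; near: n; exact: limit_set_approx.
rewrite eE; apply: (@edist_inf_le _ _ _ (n%:R^-1 *: kappa g)) => //.
  by exists g.
by rewrite distrC; apply/rescale.
Unshelve. all: by end_near. Qed.

End JointSpectrum.

(** * Zariski density from unipotent elements *)

Section Unipotent.
Context {R : realType}.
Implicit Types x y : R.

Definition upper x : 'M[R]_2 := mat22 1 x 0 1.
Definition lower x : 'M[R]_2 := mat22 1 0 x 1.

Lemma upperX x n : upper x ^+ n = upper (n%:R * x).
Proof.
elim: n => [|n IH].
  by apply: eq_mat22; rewrite expr0 !mat22E ?mul0r !mxE.
by rewrite exprS IH; apply: eq_mat22; rewrite mul22E !mat22E -?natr1; ring.
Qed.

Lemma lowerX x n : lower x ^+ n = lower (n%:R * x).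
Proof.
elim: n => [|n IH].
  by apply: eq_mat22; rewrite expr0 !mat22E ?mul0r !mxE.
by rewrite exprS IH; apply: eq_mat22; rewrite mul22E !mat22E -?natr1; ring.
Qed.

Lemma det_upper x : \det (upper x) = 1.
Proof. by rewrite det22 !mat22E; ring. Qed.

Lemma det_lower x : \det (lower x) = 1.
Proof. by rewrite det22 !mat22E; ring. Qed.

(** Gaussian elimination: a matrix with nonzero lower left entry is a product
    upper * lower * upper, and a multiplication by [lower 1] reduces the other
    case to this one. *)
Lemma SL2_unipotent_ind (P : 'M[R]_2 -> Prop) :
  (forall x, P (upper x)) -> (forall x, P (lower x)) ->
  (forall A B, P A -> P B -> P (A * B)) ->
  forall A, \det A = 1 -> P A.
Proof.
move=> Pu Pl PM.
have gen A : \det A = 1 -> A 1 0 != 0 -> P A.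
  move=> dA c0.
  suff -> : A = upper ((A 0 0 - 1) / A 1 0) * lower (A 1 0) *
      upper ((A 1 1 - 1) / A 1 0) by apply: (PM) => //; exact: PM.
  rewrite det22 in dA.
  apply: eq_mat22; rewrite !(mul22E, mat22E).
  - by field.
  - have -> : A 0 1 = (A 0 0 * A 1 1 - 1) / A 1 0.
      by rewrite -dA opprB addrC subrK mulfK.
    by field.
  - by field.
  - by field.
move=> A dA; have [c0|] := eqVneq (A 1 0) 0; last exact: gen.
have -> : A = (A * lower 1) * lower (-1).
  by rewrite -mulrA; apply: eq_mat22; rewrite !(mul22E, mat22E); ring.
apply: (PM) => //; apply: gen; first by rewrite det_mulmx dA det_lower mulr1.
rewrite mul22E !mat22E c0; apply/eqP => d0; have : 1 = 0 :> R.
  have d1 : A 1 1 = 0 by lra.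
  by rewrite -dA det22 c0 d1; ring.
by apply/eqP; exact: oner_neq0.
Qed.

End Unipotent.

Section ZariskiClosure.
Context {R : realType}.
Variable H : set (M2xM2 R).
Hypothesis algH : algebraic_subset H.

Lemma polynomial_path (p : mpoly.mpoly (2 * 2 + 2 * 2) R) (g e : M2xM2 R) :
  exists q : {poly R}, forall x,
    q.[x] = mpoly.meval (coordinates (g + (x *: e.1, x *: e.2))) p.
Proof.
pose v i : {poly R} := (coordinates g i)%:P + coordinates e i *: 'X.
exists (\sum_(m <- mpoly.msupp p) mpoly.mcoeff m p *: \prod_i v i ^+
  mpoly.fun_of_multinom m i) => x.
rewrite mpoly.mevalE horner_sum; apply: eq_bigr => m _.
rewrite hornerZ horner_prod; congr (_ * _); apply: eq_bigr => i _.
rewrite horner_exp; congr (_ ^+ _).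
rewrite /v !hornerE /coordinates !mxE.
by case: (fintype.split i) => j; rewrite linearD linearZ /= [RHS]mxE [in
  RHS](mxE scalemx_key) mulrC.
Qed.

(** A polynomial restricted to a line is a polynomial in one variable; having
    all natural numbers as roots, it is zero. *)
Lemma algebraic_line (F : R -> M2xM2 R) (g e : M2xM2 R) :
  (forall x, F x = (g.1 + x *: e.1, g.2 + x *: e.2)) ->
  (forall x, @SL2xSL2 R (F x)) -> (forall n : nat, H (F n%:R)) ->
  forall x, H (F x).
Proof.
have [P ->] := algH => FE sl Hn x; split=> // p Pp.
have [q qE] := polynomial_path p g e.
have {}qE y : mpoly.meval (coordinates (F y)) p = q.[y] by rewrite qE FE.
rewrite qE; suff -> : q = 0 by rewrite horner0.
apply/eqP; apply: contraT => q0.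
have := @max_poly_roots _ q [seq i%:R | i <- iota 0 (size q)] q0.
rewrite size_map size_iota ltnn; apply.
  apply/allP => _ /mapP[i _ ->]; rewrite /root -qE.
  by have [_ /(_ p Pp) ->] := Hn i.
by rewrite map_inj_uniq ?iota_uniq// => i j /eqP; rewrite eqr_nat => /eqP.
Qed.

Lemma unipotent_zariski_dense : H 1 ->
  (forall g h, H g -> H h -> H (g * h)) ->
  H (upper 1, 1) -> (exists2 a, a != 0 & H (lower a, 1)) ->
  H (1, upper 1) -> H (1, lower 1) -> @SL2xSL2 R `<=` H.
Proof.
move=> H1 HM Hu1 [a a0 Hl1] Hu2 Hl2.
have HX g n : H g -> H (g ^+ n).
  by move=> Hg; elim: n => [|n IH]; rewrite ?expr0// exprS; exact: HM.
have U1 x : H (upper x, 1).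
  move: x; apply: (@algebraic_line _ 1 (mat22 0 1 0 0, 0)) => [x|x|n].
  - apply: eq_pair; last by rewrite /= scaler0 addr0.
    by apply: eq_mat22; rewrite !mxE /=; ring.
  - by split; rewrite ?det_upper ?det1.
  - by have := HX _ n Hu1; rewrite pairX /= upperX expr1n mulr1.
have L1 x : H (lower x, 1).
  rewrite -[x](divfK a0); move: (x / a) => {}x; move: x.
  apply: (@algebraic_line (fun x => (lower (x * a), 1)) 1 (mat22 0 0 a 0, 0))
    => [x|x|n].
  - apply: eq_pair; last by rewrite /= scaler0 addr0.
    by apply: eq_mat22; rewrite !mxE /=; ring.
  - by split; rewrite ?det_lower ?det1.
  - by have := HX _ n Hl1; rewrite pairX /= lowerX expr1n.
have U2 x : H (1, upper x).
  move: x; apply: (@algebraic_line _ 1 (0, mat22 0 1 0 0)) => [x|x|n].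
  - apply: eq_pair; first by rewrite /= scaler0 addr0.
    by apply: eq_mat22; rewrite !mxE /=; ring.
  - by split; rewrite ?det_upper ?det1.
  - by have := HX _ n Hu2; rewrite pairX /= upperX expr1n mulr1.
have L2 x : H (1, lower x).
  move: x; apply: (@algebraic_line _ 1 (0, mat22 0 0 1 0)) => [x|x|n].
  - apply: eq_pair; first by rewrite /= scaler0 addr0.
    by apply: eq_mat22; rewrite !mxE /=; ring.
  - by split; rewrite ?det_lower ?det1.
  - by have := HX _ n Hl2; rewrite pairX /= lowerX expr1n mulr1.
move=> [A B] /= [dA dB].
have -> : (A, B) = (A, 1) * (1, B) :> M2xM2 R.
  by apply: eq_pair; rewrite /= ?mulr1 ?mul1r.
apply: (HM); [clear dB; move: A dA|clear dA; move: B dB];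
  apply: SL2_unipotent_ind => // X Y HXX HYY.
  have -> : (X * Y, 1) = (X, 1) * (Y, 1) :> M2xM2 R.
    by apply: eq_pair; rewrite /= ?mulr1.
  exact: HM.
have -> : (1, X * Y) = (1, X) * (1, Y) :> M2xM2 R.
  by apply: eq_pair; rewrite /= ?mulr1.
exact: HM.
Qed.

End ZariskiClosure.

(** * Corners of planar convex sets *)

Section Corners.
Context {R : realType}.
Implicit Types (K : set (R * R)) (p x : R * R).

(** Two distinct support lines at p. Both have a normal vector with first
    coordinate 1, which is the case for the support lines found below. *)
Definition corner K p := K p /\
  exists u v : R, u != v /\ forall x, K x ->
    x.1 + u * x.2 <= p.1 + u * p.2 /\ x.1 + v * x.2 <= p.1 + v * p.2.

Lemma corner_boundary K p : corner K p -> boundary K p.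
Proof.
move=> [Kp [u [v [_ sup]]]]; split; first exact: subset_closure.
rewrite /interior /= => /nbhs_ballP[e /= e0 pe].
have /(sup _)[] : K (p.1 + e / 2, p.2).
  apply: pe; split=> /=; last exact: ballxx.
  rewrite -ball_normE /= opprD addNKr normrN gtr0_norm ?divr_gt0//.
  by rewrite ltr_pdivrMr// ltr_pMr// ltr1n.
rewrite /= => h _; have : 0 < e / 2 by rewrite divr_gt0.
lra.
Qed.

(** A segment of K with p in its interior lies on both support lines. *)
Lemma corner_extreme K p x y (l : R) : corner K p -> K x -> K y ->
  0 < l -> l < 1 -> l *: x + (1 - l) *: y = p -> x = p.
Proof.
move=> [_ [u [v [uv sup]]]] Kx Ky l0 l1 pE.
have [xu xv] := sup _ Kx; have [yu yv] := sup _ Ky.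
have eq (w : R) : x.1 + w * x.2 <= p.1 + w * p.2 ->
    y.1 + w * y.2 <= p.1 + w * p.2 -> x.1 + w * x.2 = p.1 + w * p.2.
  move=> xw yw; apply/eqP; rewrite eq_le xw /= -(ler_pM2l l0).
  have : (1 - l) * (y.1 + w * y.2) <= (1 - l) * (p.1 + w * p.2).
    by rewrite ler_wpM2l// subr_ge0 ltW.
  have -> : p.1 = l * x.1 + (1 - l) * y.1 by rewrite -pE.
  have -> : p.2 = l * x.2 + (1 - l) * y.2 by rewrite -pE.
  lra.
have eu := eq _ xu yu; have ev := eq _ xv yv.
have uv0 : u - v != 0 by rewrite subr_eq0.
have e2 : x.2 = p.2 by apply: (mulfI uv0); lra.
have e1 : x.1 = p.1 by rewrite e2 in eu; lra.
exact: eq_pair.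
Qed.

Lemma injective_escape (c : nat -> R * R) (F : set (R * R)) :
  injective c -> finite_set F -> exists k, ~ F (c k).
Proof.
move=> cinj finF; apply: contrapT => /forallNP all_in.
apply: infinite_nat; apply: sub_finite_set (finite_preimage (f := c) _ finF).
  by move=> k _; apply: contrapT; exact: all_in.
by move=> ? ? _ _; exact: cinj.
Qed.

(** Removing an extreme point from a convex set leaves it convex, so that the
    finite set spanning K contains all corners. *)
Lemma infinite_corners_not_polygon K (c : nat -> R * R) : convex_set K ->
  injective c -> (forall k, corner K (c k)) -> ~ convex_polygon K.
Proof.
move=> Kcvx cinj Kc [S finS KE].
have [k Sk] := injective_escape cinj finS.
suff : (K `\ c k) (c k) by case=> _; exact.
suff sub : K `<=` K `\ c k by exact: sub (c k) (Kc k).1.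
rewrite [in X in X `<=` _]KE; apply: smallest_sub.
  apply/convex_setW => x y /set_mem[Kx xk] /set_mem[Ky yk] l l0 l1.
  apply/mem_set; split.
    by apply/set_mem/Kcvx; apply/mem_set.
  by move=> /= /(corner_extreme (Kc k) Kx Ky l0 l1)/xk.
move=> x Sx; split; first by rewrite KE; exact: sub_gen_smallest.
by move=> /= xk; apply: Sk; rewrite -xk.
Qed.

Lemma is_derive_functional (f : R -> R * R) (t u : R) (d : R * R) :
  is_derive t 1 f d ->
  is_derive t 1 (fun s => (f s).1 + u * (f s).2) (d.1 + u * d.2).
Proof.
move=> [fd dE].
have lc : {for d, continuous (fun x : R * R => x.1 + u * x.2)}.
  apply: cvgD; first exact: cvg_fst.
  by apply: cvgMr; exact: cvg_snd.
have fcvg : h^-1 *: ((f \o shift t) (h *: 1) - f t) @[h --> 0^'] --> d.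
  by rewrite -dE; exact: fd.
have lcvg : h^-1 *: (((fun s => (f s).1 + u * (f s).2) \o shift t) (h *: 1) -
    ((f t).1 + u * (f t).2)) @[h --> 0^'] --> d.1 + u * d.2.
  apply: cvg_trans _ (cvg_comp _ _ fcvg lc); apply: near_eq_cvg; near=> h.
  by rewrite /= /GRing.scale /=; ring.
by apply: DeriveDef; [apply/cvg_ex; exists (d.1 + u * d.2)|exact: cvg_lim lcvg].
Unshelve. all: by end_near. Qed.

Lemma breakpoint_or_interior (t : nat -> R) n s : t 0%N <= s <= t n ->
  (exists2 i, (i <= n)%N & s = t i) \/
  (exists2 i, (i < n)%N & t i < s < t i.+1).
Proof.
elim: n => [|n IH] /andP[lo hi].
  by left; exists 0%N => //; apply/eqP; rewrite eq_le lo hi.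
have [sn|ns] := leP s (t n).
  have [[i ? ?]|[i ? ?]] := IH (introT andP (conj lo sn)).
    by left; exists i => //; exact: ltnW.
  by right; exists i => //; exact: ltnW.
have [sn'|] := ltP s (t n.+1); first by right; exists n; rewrite ?ns.
by left; exists n.+1 => //; apply/eqP; rewrite eq_le hi.
Qed.

(** Choose a corner which is not the image of a breakpoint. The curve stays in
    K, so the two support functionals of the corner reach a local maximum
    along it; both kill the derivative, which therefore vanishes. *)
Lemma infinite_corners_not_piecewise_C1 K (c : nat -> R * R) : closed K ->
  injective c -> (forall k, corner K (c k)) -> ~ piecewise_C1 (boundary K).
Proof.
move=> Kcl cinj Kc [f [n [t [n0 tlt C1 bE]]]].
have [k breakk] : exists k, ~ (f @` (t @` `I_n.+1)) (c k).
  by apply: (injective_escape cinj); do 2 apply: finite_image.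
have := corner_boundary (Kc k); rewrite bE => -[s].
rewrite /= in_itv /= => /breakpoint_or_interior[[i ilen sE] fs|[i ilt sI] fs].
  by apply: breakk; exists s => //; exists i => //=; rewrite ltnS.
have [d [_ _ fd dn0]] := C1 _ ilt.
have [_ [u [v [uv sup]]]] := Kc k.
have mono j m : (j <= m <= n)%N -> t j <= t m.
  move=> /andP[jm mn]; elim: m jm mn => [|m IH];
    first by rewrite leqn0 => /eqP ->.
  rewrite leq_eqVlt => /predU1P[->//|jm mn].
  by apply: (le_trans (IH jm (ltnW mn))); exact/ltW/tlt.
have Kf r : r \in `]t i, t i.+1[ -> K (f r).
  rewrite in_itv /= => /andP[ri ir].
  suff [] : boundary K (f r) by move=> /Kcl.
  rewrite bE; exists r => //=; rewrite in_itv /=.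
  rewrite (le_trans _ (ltW ri)) ?mono//=; last by rewrite ltnW.
  by rewrite (le_trans (ltW ir))// mono// ilt leqnn.
have sI' : s \in `]t i, t i.+1[ by rewrite in_itv.
have crit w : (forall x, K x -> x.1 + w * x.2 <= (c k).1 + w * (c k).2) ->
    (d s).1 + w * (d s).2 = 0.
  move=> supw; pose l r := (f r).1 + w * (f r).2.
  have ld r : r \in `]t i, t i.+1[ -> is_derive r 1 l ((d r).1 + w * (d r).2).
    by move=> /fd; exact: is_derive_functional.
  have lmax : is_derive s 1 l 0.
    apply: derive1_at_max (ltW (tlt _ ilt)) _ sI' _ => r rI.
      by have [] := ld _ rI.
    by rewrite /l fs; exact/supw/Kf.
  have [_ <-] := ld _ sI'; by have [_] := lmax.
have du : (d s).1 + u * (d s).2 = 0 by apply: crit => x /sup[].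
have dv : (d s).1 + v * (d s).2 = 0 by apply: crit => x /sup[].
have uv0 : u - v != 0 by rewrite subr_eq0.
have d2 : (d s).2 = 0 by apply: (mulfI uv0); lra.
have d1 : (d s).1 = 0 by rewrite d2 in du; lra.
have /negP[] : d s != 0 by apply: dn0; apply: subset_itv_oo_cc sI'.
by apply/eqP/eq_pair.
Qed.

End Corners.

(** * The generators and their spectrum *)

Section Generators.
Context {R : realType}.
Implicit Types (g h : M2xM2 R) (n k j m : nat) (x y s t u : R).

Definition dilation : 'M[R]_2 := mat22 2 0 0 2^-1.

Definition generators : set (M2xM2 R) :=
  [set 1; (upper 1, dilation); (upper 1, 1); (lower 2, 1);
    (1, upper 1); (1, lower 1)].

Lemma generators_finite : finite_set generators.
Proof. by rewrite /generators !finite_setU; do !split; exact: finite_set1. Qed.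

Lemma generatorsP (P : M2xM2 R -> Prop) : P 1 -> P (upper 1, dilation) ->
  P (upper 1, 1) -> P (lower 2, 1) -> P (1, upper 1) -> P (1, lower 1) ->
  forall g, generators g -> P g.
Proof. by move=> ? ? ? ? ? ? g [[[[[->|->]|->]|->]|->]|->]. Qed.

Lemma generators_SL2 : generators `<=` @SL2xSL2 R.
Proof.
apply: generatorsP; split; rewrite /= ?det1 ?det_upper ?det_lower//.
by rewrite det22 !mat22E; field.
Qed.

Lemma generators_dense : zariski_dense (generated_semigroup generators).
Proof.
move=> H [algH H1 HM _] SH.
have HT g : generators g -> H g.
  by move=> Tg; apply: SH; exists 1%N => //; exact: set_power1.
apply/seteqP; split; first by have [P ->] := algH => g [].
apply: unipotent_zariski_dense => //.
- by apply: HT; rewrite /generators /=; tauto.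
- by exists 2 => //; apply: HT; rewrite /generators /=; tauto.
- by apply: HT; rewrite /generators /=; tauto.
- by apply: HT; rewrite /generators /=; tauto.
Qed.

Lemma tame_letter1 : tame_letter (1 : 'M[R]_2).
Proof. by split; [exact: nonneg_sl1|..]; rewrite !mxE /=; lra. Qed.

Lemma tame_upper : tame_letter (upper 1 : 'M[R]_2).
Proof.
by split; [split; rewrite ?det_upper //|..]; rewrite !mat22E /=; lra.
Qed.

Lemma tame_lower x : 0 <= x <= 2 -> tame_letter (lower x).
Proof.
move=> /andP[x0 x2].
by split; [split; rewrite ?det_lower //|..]; rewrite !mat22E /=; lra.
Qed.

Lemma tame_dilation : tame_letter dilation.
Proof.
by split; [split|..]; rewrite ?det22 !mat22E /=; lra.
Qed.

Lemma tame_generators g : generators g -> tame_letter g.1 /\ tame_letter g.2.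
Proof.
have t1 := tame_letter1; have tu := tame_upper; have td := tame_dilation.
have tl2 : tame_letter (lower (2 : R)) by apply: tame_lower; lra.
have tl1 : tame_letter (lower (1 : R)) by apply: tame_lower; lra.
by move: g; apply: generatorsP.
Qed.

Lemma generators1 : generators 1.
Proof. by rewrite /generators /=; tauto. Qed.

Definition spectrum := limit_set generators.

(** The larger eigenvalue of U(1)^k L(2), whose trace is 2 + 2k. *)
Definition rho k : R := 1 + k%:R + Num.sqrt (k%:R ^+ 2 + 2 * k%:R).

Lemma rho_bounds k : 2 * k%:R + 1 <= rho k <= 2 * k%:R + 2.
Proof.
have k0 : 0 <= k%:R :> R by [].
have lo : k%:R <= Num.sqrt (k%:R ^+ 2 + 2 * k%:R) :> R.
  by rewrite -[leLHS](ger0_norm k0) -sqrtr_sqr ler_wsqrtr// lerDl mulr_ge0.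
have hi : Num.sqrt (k%:R ^+ 2 + 2 * k%:R) <= k%:R + 1 :> R.
  have k10 : 0 <= k%:R + 1 :> R by rewrite addr_ge0.
  rewrite -[leRHS](ger0_norm k10) -sqrtr_sqr ler_wsqrtr// !expr2; lra.
by rewrite /rho; apply/andP; split; lra.
Qed.

Lemma rho_sqr k : rho k * rho k = (2 + 2 * k%:R) * rho k - 1.
Proof.
have k0 : 0 <= k%:R :> R by [].
rewrite /rho; set q := Num.sqrt _.
have : q ^+ 2 = k%:R ^+ 2 + 2 * k%:R by rewrite sqr_sqrtr// addr_ge0//
  ?mulr_ge0// sqr_ge0.
rewrite !expr2; lra.
Qed.

Lemma rho_trace k : 2 + 2 * k%:R = rho k + (rho k)^-1.
Proof.
have /andP[lo _] := rho_bounds k; have k0 : 0 <= k%:R :> R by [].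
have r0 : rho k != 0 by apply: lt0r_neq0; lra.
by apply: (mulIf r0); rewrite [RHS]mulrDl mulVf// rho_sqr subrK.
Qed.

(** The logarithms of the eigenvalues of (U(1), D)^k (L(2), 1), per letter. *)
Definition corner_point k : R * R :=
  (k.+1%:R^-1 * ln (rho k), k.+1%:R^-1 * (k%:R * ln 2)).

Lemma spectrum_corner_point k : spectrum (corner_point k).
Proof.
have /andP[lo _] := rho_bounds k; have k0 : 0 <= k%:R :> R by [].
have Ta : generators (upper 1, dilation) by rewrite /generators /=; tauto.
have Tb : generators (lower 2, 1) by rewrite /generators /=; tauto.
have gT : set_power generators (1 * k + 1)
    ((upper 1, dilation) ^+ k * (lower 2, 1)).
  by apply: set_powerD; [exact/set_powerX/set_power1|exact: set_power1].
rewrite mul1n addn1 in gT.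
have := limit_set_power tame_generators generators1 (r1 := rho k)
  (r2 := 2 ^+ k) (ltn0Sn k) gT.
have -> : ln (2 ^+ k) = k%:R * ln 2 :> R by rewrite lnXn// mulr_natl.
apply.
- lra.
- by rewrite exprn_ege1// ler1n.
- by rewrite pairX /= upperX tr22 !mul22E !mat22E -rho_trace; ring.
- rewrite pairX /= mulr1; apply: trace_exp => //.
    by rewrite det22 !mat22E; field.
  by rewrite tr22 !mat22E.
Qed.

Lemma corner_point_inj : injective corner_point.
Proof.
move=> j k [_]; have l2 : ln 2 != 0 :> R by rewrite gt_eqF// ln_gt0// ltr1n.
rewrite !mulrA => /(mulIf l2) jk.
have j0 : j.+1%:R != 0 :> R by rewrite pnatr_eq0.
have k0 : k.+1%:R != 0 :> R by rewrite pnatr_eq0.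
have : k.+1%:R * j%:R = j.+1%:R * k%:R :> R.
  by apply: (mulfI (invr_neq0 j0)); apply: (mulfI (invr_neq0 k0));
    rewrite mulrCA mulKf// jk mulKf.
by rewrite -!natrM => /eqP; rewrite eqr_nat => /eqP; lia.
Qed.

(** The words (U(1), D) and (U(1), 1)(L(2), 1) give points on the two axes,
    which span a triangle together with the origin. *)
Lemma spectrum_interior : spectrum° !=set0.
Proof.
have Ta : generators (upper 1, dilation) by rewrite /generators /=; tauto.
have Tu : generators (upper 1, 1) by rewrite /generators /=; tauto.
have Tl : generators (lower 2, 1) by rewrite /generators /=; tauto.
have l2 : 0 < ln 2 :> R by rewrite ln_gt0// ltr1n.
have pA : spectrum (0, ln 2).
  have := limit_set_power tame_generators generators1 (r1 := 1) (r2 := 2)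
    (ltn0Sn 0) (set_power1 Ta).
  rewrite ln1 invr1 scale1r; apply => //; first by rewrite ler1n.
    by rewrite tr22 !mat22E.
  by rewrite tr22 !mat22E.
have /andP[rlo _] := rho_bounds 1.
pose q : R := 2^-1 * ln (rho 1).
have q0 : 0 < q by rewrite mulr_gt0 ?invr_gt0// ln_gt0//; lra.
have pB : spectrum (q, 0).
  have := limit_set_power tame_generators generators1 (r1 := rho 1) (r2 := 1)
    (ltn0Sn 1) (set_powerS Tu (set_power1 Tl)).
  have -> : 2%:R^-1 *: (ln (rho 1), ln 1) = (q, 0).
    by apply: eq_pair; rewrite /= ?ln1 ?scaler0.
  apply => //; first by lra.
    by rewrite -rho_trace /= tr22 !mul22E !mat22E; lra.
  by rewrite /= mulr1 tr22 !mxE /= invr1.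
have triangle x y : 0 < x -> 0 < y -> x / q + y / ln 2 < 1 -> spectrum (x, y).
  move=> x0 y0; have xq : 0 < x / q by rewrite divr_gt0.
  have yl : 0 < y / ln 2 by rewrite divr_gt0.
  set w := x / q + y / ln 2 => w1; have w0 : 0 < w by rewrite addr_gt0.
  have wn0 := lt0r_neq0 w0.
  have s1 : 1 - x / q / w = y / ln 2 / w.
    by apply: (mulIf wn0); rewrite mulrBl !divfK// mul1r /w addrC addKr.
  have pC : spectrum (x / q / w *: (q, 0) + (1 - x / q / w) *: (0, ln 2)).
    apply: (limit_set_convex_comb tame_generators pB pA);
      first by rewrite divr_gt0.
    by rewrite -subr_gt0 s1 divr_gt0.
  have := limit_set_convex_comb tame_generators pC (limit_set0 tame_generators
    generators1) w0 w1.
  rewrite s1 scaler0 addr0; congr (limit_set _ _).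
  have qn0 := lt0r_neq0 q0; have ln0 := lt0r_neq0 l2.
  apply: eq_pair; rewrite /= scaler0 ?addr0 ?add0r /GRing.scale /=.
    by rewrite mulrCA mulrA !divfK.
  by rewrite mulrCA mulrA !divfK.
exists (q / 4, ln 2 / 4); rewrite /interior /=; apply/nbhs_ballP.
pose e := Num.min (q / 4) (ln 2 / 4).
exists e; first by rewrite /= lt_min !divr_gt0.
move=> [x y] [] /=; rewrite -!ball_normE /= => xe ye.
have : `|q / 4 - x| < q / 4 by apply: lt_le_trans xe _; rewrite ge_min lexx.
have : `|ln 2 / 4 - y| < ln 2 / 4.
  by apply: lt_le_trans ye _; rewrite ge_min lexx orbT.
rewrite !ltr_norml => /andP[y1 y2] /andP[x1 x2].
apply: triangle; [lra|lra|].
have : x / q < 1 / 2 by rewrite ltr_pdivrMr//; lra.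
have : y / ln 2 < 1 / 2 by rewrite ltr_pdivrMr//; lra.
lra.
Qed.

End Generators.

(** * Support lines at the corner points *)

Section SupportLines.
Context {R : realType}.
Implicit Types (g h : M2xM2 R) (j m n : nat).

(** An affine function of m, of value Q at 0, lies below Q t^m at all positive
    and negative integers as soon as it does at 1 and at -1: this is Bernoulli's
    inequality. *)
Lemma tangent_bound (Q S t : R) m : 0 <= Q -> 0 <= S -> 1 <= t ->
  S <= (t - 1) * Q -> (t - 1) * Q <= t * S ->
  Q + m%:R * S <= Q * t ^+ m /\ (Q - m%:R * S) * t ^+ m <= Q.
Proof.
move=> Q0 S0 t1 up lo; have t0 : 0 <= t by apply: le_trans t1.
elim: m => [|m [IH1 IH2]]; first by rewrite mul0r expr0 addr0 subr0 mulr1.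
have mS : 0 <= m%:R * S by rewrite mulr_ge0.
have tm0 : 0 <= t ^+ m by rewrite exprn_ge0.
rewrite -!natr1 !exprS; split.
  have h1 : (Q + m%:R * S) * t <= Q * t ^+ m * t by rewrite ler_wpM2r.
  have h2 : 0 <= (t - 1) * (m%:R * S) by rewrite mulr_ge0// subr_ge0.
  lra.
have h1 : ((Q - m%:R * S) - S) * t <= Q - m%:R * S.
  have h2 : 0 <= (t - 1) * (m%:R * S) by rewrite mulr_ge0// subr_ge0.
  lra.
have : ((Q - m%:R * S) - S) * t * t ^+ m <= (Q - m%:R * S) * t ^+ m.
  by rewrite ler_wpM2r.
lra.
Qed.

Variables (k : nat) (t : R).
Hypothesis k8 : (8 <= k)%N.
Hypothesis t_lo : 3 * k%:R + 4 <= t * (3 * k%:R + 1).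
Hypothesis t_hi : t * k%:R <= k%:R + 1.

Local Notation rho := (@rho R k).
Local Notation K := (k%:R : R).

Let K8 : 8 <= K. Proof. by rewrite ler_nat. Qed.

Let rho_lo : 2 * K + 1 <= rho. Proof. by case/andP: (@rho_bounds R k). Qed.

Let rho_hi : rho <= 2 * K + 2. Proof. by case/andP: (@rho_bounds R k). Qed.

Let t1 : 1 < t.
Proof. by rewrite -(@ltr_pM2r _ (3 * K + 1)); move: t_lo K8; lra. Qed.

(** The left eigenvector of U(1)^k L(2) for the eigenvalue [rho]. *)
Definition eigenform (x1 x2 : R) := (rho - 1) * x1 + K * x2.

(** The form to control after reading a word depends on how many letters U(1)
    are still to come before the next L(2). Bounding it for every number j of
    such letters makes the bound compatible with reading one letter at a time.
    *)
Definition ladder (x1 x2 G : R) :=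
  forall j, eigenform (x1 + j%:R * x2) x2 * t ^+ k <= G * t ^+ j.

(** After a letter L(2), the vector (x1, 2 x1 + x2) has its direction in a
    narrow cone, so that the relative slope S / Q lies between 1 / (k + 1) and
    3 / (3 k + 1): this is where the two hypotheses on t come from. *)
Lemma ladder_lower x1 x2 : 0 <= x1 -> 0 <= x2 ->
  ladder x1 (2 * x1 + x2) (rho * eigenform x1 x2).
Proof.
move=> x10 x20 j; set w2 := 2 * x1 + x2.
have w20 : 0 <= w2 by rewrite /w2; lra.
have r0 : 0 <= rho - 1 by move: rho_lo K8; lra.
pose Q := rho * eigenform x1 x2; pose S := (rho - 1) * w2.
have QE : Q = (rho - 1) * (x1 + K * w2) + K * w2.
  rewrite /Q /eigenform /w2.
  have -> : rho * ((rho - 1) * x1 + K * x2) =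
    rho * rho * x1 - rho * x1 + rho * K * x2 by ring.
  by rewrite rho_sqr; ring.
have jE : eigenform (x1 + j%:R * w2) w2 = Q + (j%:R - K) * S.
  by rewrite QE /eigenform /S; ring.
have S0 : 0 <= S by rewrite mulr_ge0.
have rx1 : 0 <= (rho - 1) * x1 by rewrite mulr_ge0.
have rx2 : 0 <= (rho - 1) * x2 by rewrite mulr_ge0.
have Q_lo : (3 * K + 1) * S <= 3 * Q.
  have : (rho - 1) * w2 <= 3 * K * w2.
    by rewrite ler_wpM2r//; move: rho_hi K8; lra.
  by rewrite QE /S; lra.
have Q_hi : Q <= (K + 1) * S.
  have : 2 * K * w2 <= (rho - 1) * w2.
    by rewrite ler_wpM2r//; move: rho_lo K8; lra.
  by rewrite QE /S /w2; lra.
have Q0 : 0 <= Q by move: Q_lo K8 S0; nra.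
have up : S <= (t - 1) * Q.
  have h1 : (t - 1) * ((3 * K + 1) * S) <= (t - 1) * (3 * Q).
    by rewrite ler_wpM2l// subr_ge0 ltW.
  have h2 : 3 * S <= (t - 1) * (3 * K + 1) * S.
    by rewrite ler_wpM2r//; move: t_lo; lra.
  lra.
have lo : (t - 1) * Q <= t * S.
  have h1 : (t - 1) * Q <= (t - 1) * ((K + 1) * S).
    by rewrite ler_wpM2l// subr_ge0 ltW.
  have h2 : (t - 1) * (K + 1) * S <= t * S.
    by rewrite ler_wpM2r//; move: t_hi; lra.
  lra.
have t0 : 0 <= t by move: t1; lra.
rewrite jE -/Q; have [kj|jk] := leqP k j.
  have [h _] := tangent_bound (j - k) Q0 S0 (ltW t1) up lo.
  rewrite natrB// in h; rewrite -(subnK kj) exprD mulrA ler_wpM2r ?exprn_ge0//.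
  by rewrite subnK.
have [_ h] := tangent_bound (k - j) Q0 S0 (ltW t1) up lo.
rewrite natrB 1?ltnW// in h.
rewrite -[in t ^+ k](subnK (ltnW jk)) exprD mulrA ler_wpM2r ?exprn_ge0//.
by apply: le_trans h; rewrite -opprB mulNr.
Qed.

(** The weight of the second coordinate for which (U(1), D) and (L(2), 1) have
    the same cost per letter, see [C_slope]. *)
Definition slope : R := (ln rho - ln t * k.+1%:R) / ln 2.

(** The slope is nonnegative because log t is at most 1 / k; the bound
    8 <= k ensures that 2 k + 1 >= 2^4, and log 2 >= 1 / 2. *)
Lemma ln_rho_ge2 : 2 <= ln rho.
Proof.
have half : 2^-1 <= ln 2 :> R.
  have : ln 2^-1 <= - 2^-1 :> R.
    have e : 1 + - 2^-1 = 2^-1 :> R by lra.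
    by have := @le_ln1Dx R (- 2^-1); rewrite e; apply; lra.
  by rewrite lnV ?posrE//; lra.
apply: (@le_trans _ _ (ln (2 ^+ 4))); first by rewrite lnXn// -(mulr_natl (ln
  2)); lra.
by rewrite ler_ln ?posrE//; move: rho_lo K8; lra.
Qed.

Lemma slope_ge0 : 0 <= slope.
Proof.
have l2 : 0 < ln 2 :> R by rewrite ln_gt0// ltr1n.
rewrite divr_ge0 ?(ltW l2)// subr_ge0; apply: le_trans ln_rho_ge2.
have lt : ln t <= t - 1.
  by rewrite -[t in ln t](subrK 1) addrC le_ln1Dx//; move: t1; lra.
have : ln t * (K + 1) <= (t - 1) * (K + 1).
  by rewrite ler_wpM2r//; move: K8; lra.
by rewrite -natr1; move: t_hi K8 t1; nra.
Qed.

Lemma slopeE : slope * ln 2 = ln rho - ln t * k.+1%:R.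
Proof. by rewrite divfK// gt_eqF// ln_gt0// ltr1n. Qed.

(* The growth per letter of the weighted log-norm. *)
Let C := ln rho - ln t * K.

Lemma C_slope : C = ln t + slope * ln 2.
Proof. by rewrite slopeE /C -natr1; ring. Qed.

(** G and Y bound the growth in the two factors. The starting vector is (1, 2),
    which lies in the cone reached after a letter L(2). *)
Definition dominated n g (c : R) := exists G Y : R,
  [/\ 0 < G /\ 0 < Y,
      ladder (g.1 0 0 + 2 * g.1 0 1) (g.1 1 0 + 2 * g.1 1 1) G,
      entry_sum g.2 <= Y & ln G + slope * ln Y <= c + n%:R * C].

Lemma dominated_step n a h c : nonneg_sl h.1 -> nonneg_sl h.2 ->
  generators a -> dominated n h c -> dominated n.+1 (a * h) c.
Proof.
move=> sh1 sh2 Ta [G [Y [[G0 Y0] lad sumY bound]]].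
have l2 : 0 < ln 2 :> R by rewrite ln_gt0// ltr1n.
have lt0 : 0 < ln t by rewrite ln_gt0.
have sl0 := slope_ge0.
have sl2 : 0 <= slope * ln 2 by rewrite mulr_ge0// ltW.
have t0 : 0 < t by move: t1; lra.
have r0 : 0 < rho by move: rho_lo K8; lra.
have CE := C_slope.
have nC : n.+1%:R * C = n%:R * C + C by rewrite -natr1; ring.
have ln2Y : ln (2 * Y) = ln 2 + ln Y by rewrite lnM ?posrE.
have lnGt : ln (G * t) = ln G + ln t by rewrite lnM ?posrE.
have [a00 b00 c00 d00 _] := sh1; have [a01 b01 c01 d01 _] := sh2.
have up : ladder ((upper 1 * h.1) 0 0 + 2 * (upper 1 * h.1) 0 1)
    ((upper 1 * h.1) 1 0 + 2 * (upper 1 * h.1) 1 1) (G * t).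
  move=> j; have := lad j.+1; rewrite !(mul22E, mat22E) exprS mulrA -natr1.
  rewrite /eigenform; congr (_ * _ <= _); ring.
have low : ladder ((lower 2 * h.1) 0 0 + 2 * (lower 2 * h.1) 0 1)
    ((lower 2 * h.1) 1 0 + 2 * (lower 2 * h.1) 1 1) (rho * G / t ^+ k).
  move=> j; rewrite !(mul22E, mat22E).
  set x1 := h.1 0 0 + 2 * h.1 0 1; set x2 := h.1 1 0 + 2 * h.1 1 1.
  have x10 : 0 <= x1 by rewrite /x1; lra.
  have x20 : 0 <= x2 by rewrite /x2; lra.
  have -> : 1 * h.1 0 0 + 0 * h.1 1 0 + 2 * (1 * h.1 0 1 + 0 * h.1 1 1) = x1.
    by rewrite /x1; ring.
  have -> : 2 * h.1 0 0 + 1 * h.1 1 0 + 2 * (2 * h.1 0 1 + 1 * h.1 1 1) =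
      2 * x1 + x2 by rewrite /x1 /x2; ring.
  apply: le_trans (ladder_lower x10 x20 j) _.
  rewrite ler_wpM2r ?exprn_ge0 ?(ltW t0)// -mulrA ler_pM2l//.
  rewrite ler_pdivlMr ?exprn_gt0//.
  by have := lad 0%N; rewrite mul0r addr0 expr0 mulr1.
have lnlow : ln (rho * G / t ^+ k) = ln G + C.
  rewrite ln_div ?posrE ?mulr_gt0 ?exprn_gt0// lnM ?posrE// lnXn// /C.
  by rewrite -mulr_natr; ring.
have sl2Y : slope * (ln 2 + ln Y) = slope * ln 2 + slope * ln Y by ring.
have Gt0 : 0 < G * t by rewrite mulr_gt0.
have Y20 : 0 < 2 * Y by rewrite mulr_gt0.
move: a Ta; apply: generatorsP; rewrite /dominated /= ?mul1r.
- exists G, Y; split=> //; rewrite nC; lra.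
- exists (G * t), (2 * Y); split=> //.
    by move: sumY; rewrite /entry_sum !(mul22E, mat22E); lra.
  by rewrite lnGt ln2Y nC sl2Y; lra.
- exists (G * t), Y; split=> //; rewrite lnGt nC; lra.
- exists (rho * G / t ^+ k), Y; split=> //; last by rewrite lnlow nC; lra.
  by split=> //; rewrite divr_gt0 ?mulr_gt0 ?exprn_gt0.
- exists G, (2 * Y); split=> //.
    by move: sumY; rewrite /entry_sum !(mul22E, mat22E); lra.
  by rewrite ln2Y nC sl2Y; lra.
- exists G, (2 * Y); split=> //.
    by move: sumY; rewrite /entry_sum !(mul22E, mat22E); lra.
  by rewrite ln2Y nC sl2Y; lra.
Qed.

Lemma dominated_log_norm n g c : nonneg_sl g.1 -> nonneg_sl g.2 ->
  dominated n g c -> log_norm g.1 + slope * log_norm g.2 <= c + n%:R * C.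
Proof.
move=> s1 s2 [G [Y [[G0 Y0] lad sumY bound]]].
have pos A : nonneg_sl A -> 0 < entry_sum (A : 'M[R]_2).
  move=> sA; apply: lt_le_trans (nonneg_sl_entry_sum sA).
  by apply: lt_le_trans ltr01 _; case: sA.
have /andP[_ hi1] := log_norm_bounds s1.
have /andP[_ hi2] := log_norm_bounds s2.
have [a b c' d _] := s1.
have h1 : ln (entry_sum g.1) <= ln G.
  rewrite ler_ln ?posrE ?pos//; have := lad 0%N;
    rewrite mul0r addr0 expr0 mulr1.
  apply: le_trans; set E := eigenform _ _.
  have EE : entry_sum g.1 <= E.
    rewrite /E /eigenform /entry_sum.
    have k0 : g.1 1 0 + 2 * g.1 1 1 <= K * (g.1 1 0 + 2 * g.1 1 1).
      by rewrite ler_peMl//; [lra|move: K8; lra].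
    have k1 : g.1 0 0 + 2 * g.1 0 1 <= (rho - 1) * (g.1 0 0 + 2 * g.1 0 1).
      by rewrite ler_peMl//; [lra|move: rho_lo K8; lra].
    lra.
  apply: (le_trans EE); rewrite ler_peMr//; last by rewrite exprn_ege1// ltW.
  by apply: le_trans EE; apply/ltW/pos.
have h2 : ln (entry_sum g.2) <= ln Y by rewrite ler_ln ?posrE ?pos.
have : slope * log_norm g.2 <= slope * ln Y.
  by rewrite ler_wpM2l ?slope_ge0//; lra.
lra.
Qed.

Lemma spectrum_support x : @spectrum R x ->
  x.1 + slope * x.2 <= (corner_point k).1 + slope * (corner_point k).2.
Proof.
move=> Jx.
have -> : (corner_point k).1 + slope * (corner_point k).2 = C.
  rewrite /corner_point /=.
  have -> : k.+1%:R^-1 * ln rho + slope * (k.+1%:R^-1 * (K * ln 2)) =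
    k.+1%:R^-1 * (ln rho + K * (slope * ln 2)) by ring.
  apply: (mulfI (_ : k.+1%:R != 0)); first by rewrite pnatr_eq0.
  by rewrite mulVKf ?pnatr_eq0// slopeE /C -natr1; ring.
rewrite -[x.1]mul1r.
(* The starting vector (1, 2) is L(2) applied to (1, 0). *)
pose G0 := rho * eigenform 1 0.
have G00 : 0 < G0.
  by rewrite /G0 /eigenform mulr0 addr0 mulr1 mulr_gt0//; move: rho_lo K8; lra.
apply: (@limit_set_linear _ _ _ _ (ln G0 + slope * ln 2)); last exact: Jx.
move=> n g gn.
suff [s1 s2 dom] : [/\ nonneg_sl g.1, nonneg_sl g.2 &
    dominated n g (ln G0 + slope * ln 2)].
  by rewrite mul1r; exact: dominated_log_norm.
move: n g gn; apply: set_power_ind => [|n a h Ta [s1 s2 dom]].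
  split; try exact: nonneg_sl1.
  exists G0, 2; split=> //; last by rewrite mul0r addr0.
    have := @ladder_lower 1 0 ler01 (lexx _).
    by rewrite !mxE /= !(mulr0, mulr1, addr0, add0r).
  by rewrite /entry_sum !mxE /=; lra.
have [[l1 _ _ _ _] [l2 _ _ _ _]] := tame_generators Ta.
by split; [exact: nonneg_slM|exact: nonneg_slM|exact: dominated_step].
Qed.

End SupportLines.

Lemma spectrum_corner (R : realType) k : (8 <= k)%N ->
  corner (@spectrum R) (corner_point k).
Proof.
move=> k8; split; first exact: spectrum_corner_point.
have k0 : 0 < k%:R :> R by rewrite ltr0n; lia.
have d0 : 0 < 3 * k%:R + 1 :> R by lra.
(* The two extreme values of t allowed by the hypotheses of the section. *)
pose t : R := (3 * k%:R + 4) / (3 * k%:R + 1).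
pose t' : R := (k%:R + 1) / k%:R.
have tt' : t < t'.
  rewrite ltr_pdivrMr// mulrAC ltr_pdivlMr//; lra.
have t_lo : 3 * k%:R + 4 <= t * (3 * k%:R + 1) by rewrite divfK// lt0r_neq0.
have t'_hi : t' * k%:R <= k%:R + 1 by rewrite divfK// lt0r_neq0.
have t_hi : t * k%:R <= k%:R + 1.
  by apply: le_trans t'_hi; rewrite ler_wpM2r// ltW.
have t'_lo : 3 * k%:R + 4 <= t' * (3 * k%:R + 1).
  by apply: (le_trans t_lo); rewrite ler_wpM2r// ltW.
exists (slope k t), (slope k t'); split; last first.
  by move=> x Jx; split; exact: spectrum_support.
have t0 : 0 < t by rewrite divr_gt0//; lra.
have l2 : ln 2 != 0 :> R by rewrite gt_eqF// ln_gt0// ltr1n.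
apply: contraTneq tt' => /(mulIf (invr_neq0 l2)) /addrI /oppr_inj.
have kn0 : k.+1%:R != 0 :> R by rewrite pnatr_eq0.
move=> /(mulIf kn0) /ln_inj -> //; rewrite ?ltxx// posrE divr_gt0//; lra.
Qed.

Unset Implicit Arguments.

Theorem proposition1p13 (R : realType) :
  exists T : set (M2xM2 R),
    [/\ finite_set T,
        T `<=` @SL2xSL2 R,
        zariski_dense (generated_semigroup T) &
        exists J : set (R * R),
          [/\ is_joint_spectrum T J,
              J `<=` [set p | 0 <= p.1 /\ 0 <= p.2],
              convex_body J,
              ~ piecewise_C1 (boundary J) &
              ~ convex_polygon J]].
Proof.
have tame := @tame_generators R; have gen1 := @generators1 R.
have corners k : corner (@spectrum R) (corner_point (k + 8)).
  by apply: spectrum_corner; rewrite leq_addl.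
have inj : injective (fun k => corner_point (k + 8) : R * R).
  by move=> j k /corner_point_inj/addIn.
exists generators; split.
- exact: generators_finite.
- exact: generators_SL2.
- exact: generators_dense.
exists spectrum; split.
- exact: joint_spectrum_limit_set.
- by move=> x; exact: limit_set_ge0.
- split; [exact: limit_set_compact|exact: limit_set_convex|].
  exact: spectrum_interior.
- by apply: infinite_corners_not_piecewise_C1 inj corners;
  exact: limit_set_closed.
- by apply: infinite_corners_not_polygon inj corners; exact: limit_set_convex.
Qed.
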